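(* Consider problem (P), the reformulated problem (R), and the iterates of the distributed IPLUX algorithm (Algorithm D) described in the context, with parameters $\gamma,\lambda,\rho,\alpha>0$. Suppose the matrices $P^W,P^H\in\mathbb{R}^{n\times n}$ satisfy: (i) $[P^W]_{ij}=[P^H]_{ij}=0$ for all $i\in\mathcal{V}$, $j\notin\mathcal{N}_i\cup\{i\}$; (ii) $P^W$ and $P^H$ are symmetric positive semidefinite; (iii) $P^W\mathbf{1}_n=\mathbf{1}_n$ and $\operatorname{Null}(P^H)=\operatorname{span}(\mathbf{1}_n)$; (iv) $P^W+P^H\preceq I_n$. Suppose further that problem (P) satisfies: (a) each $f_i$ and $h_i$, $i\in\mathcal{V}$, is convex on $\operatorname{dom}(h_i)$, and $\operatorname{dom}(h_i)$ is convex; (b) each $f_i$ is differentiable on $\operatorname{dom}(h_i)$ and $\nabla f_i$ is Lipschitz continuous with constant $L_f>0$ on $\operatorname{dom}(h_i)$; (c) each $g_i$, $i\in\mathcal{V}$, is convex (entrywise) and Lipschitz continuous with constant $L_g>0$ on $\operatorname{dom}(h_i)$; (d) each $g_{ij}^s$, $i\in\mathcal{V}^{\mathrm{in}}$, $j\in S_i^{\mathrm{in}}$, is convex (entrywise) and Lipschitz continuous with constant $L_{g^s}>0$ on $\operatorname{dom}(h_j)$; (e) problem (P) has at least one optimal solution $\mathbf{x}^\star=[(x_1^\star)^T,\dots,(x_n^\star)^T]^T$; (f) there exist $\tilde{x}_i$ in the relative interior of $\operatorname{dom}(h_i)$, $i\in\mathcal{V}$, such that $\sum_{i\in\mathcal{V}}g_i(\tilde{x}_i)<\mathbf{0}$,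 $\sum_{i\in\mathcal{V}}A_i\tilde{x}_i=\sum_{i\in\mathcal{V}}b_i$, $\sum_{j\in S_i^{\mathrm{in}}}g_{ij}^s(\tilde{x}_j)<\mathbf{0}$ for all $i\in\mathcal{V}^{\mathrm{in}}$, and $\sum_{j\in S_i^{\mathrm{eq}}}A_{ij}^s\tilde{x}_j=b_i^s$ for all $i\in\mathcal{V}^{\mathrm{eq}}$. Let $L=\Bigl(\bigl(\max_{i\in\mathcal{V}}\sum_{j\in\mathcal{V}^{\mathrm{in}}:\,i\in S_j^{\mathrm{in}}}|S_j^{\mathrm{in}}|\bigr)L_{g^s}^2+1+L_g^2\Bigr)^{1/2}$ and suppose $\alpha\ge L_f+L^2$ and $\lambda\ge\|\mathbf{B}^s\|_2$. Let $\bar x_i(k)=\frac1k\sum_{\ell=1}^kx_i(\ell)$ for $i\in\mathcal{V}$, $k\ge1$. Then, with the constants $V_{\mathbf{q}},V_{\mathbf{u}},V_{\mathbf{v}},R_\Phi,R_\Phi'\in[0,\infty)$ defined in the context, for every $k\ge1$, $$\sum_{i\in\mathcal{V}}g_i(\bar x_i(k))\le\frac{nV_{\mathbf{q}}+\rho V_{\mathbf{u}}}{k}\mathbf{1}_{\tilde p},$$ $$\sum_{j\in S_i^{\mathrm{in}}}g_{ij}^s(\bar x_j(k))\le\frac{V_{\mathbf{q}}}{k}\mathbf{1}_{p_i},\quad\forall i\in\mathcal{V}^{\mathrm{in}},$$ $$\Bigl\|\sum_{i\in\mathcal{V}}(A_i\bar x_i(k)-b_i)\Bigr\|\le\frac{\rho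 V_{\mathbf{u}}}{k},$$ $$\Bigl\|\Bigl(\sum_{j\in S_i^{\mathrm{eq}}}A_{ij}^s\bar x_j(k)\Bigr)-b_i^s\Bigr\|\le\frac{V_{\mathbf{v}}}{\gamma k},\quad\forall i\in\mathcal{V}^{\mathrm{eq}},$$ $$-\frac{R_\Phi}{k}\le\sum_{i\in\mathcal{V}}\bigl((f_i+h_i)(\bar x_i(k))-(f_i+h_i)(x_i^\star)\bigr)\le\frac{R_\Phi'}{k}.$$
   Context: Notation: $\|\cdot\|$ is the Euclidean norm, $\|\cdot\|_2$ the spectral norm; for symmetric positive semidefinite $A$, $A^\dag$ is its Moore-Penrose inverse and $\|x\|_A=\sqrt{x^TAx}$. Vector inequalities and $\max$ of vectors are entrywise. $\mathbf{1}$ is the all-one vector (of proper dimension), $\operatorname{diag}$ denotes block diagonal matrices, $\operatorname{dom}(h)=\{x: h(x)<+\infty\}$. Problem (P). Let $\mathcal{V}=\{1,\dots,n\}$, $x_i\in\mathbb{R}^{d_i}$: $$\min_{x_i,\,i\in\mathcal{V}}\ \sum_{i\in\mathcal{V}}(f_i(x_i)+h_i(x_i))\ \text{ s.t. }\ \sum_{i\in\mathcal{V}}g_i(x_i)\le\mathbf{0}_{\tilde p},\ \ \sum_{i\in\mathcal{V}}A_ix_i=\sum_{i\in\mathcal{V}}b_i,\ \ \sum_{j\in S_i^{\mathrm{in}}}g_{ij}^s(x_j)\le\mathbf{0}_{p_i}\ \forall i\in\mathcal{V}^{\mathrm{in}},\ \ \sum_{j\in S_i^{\mathrm{eq}}}A_{ij}^sx_j=b_i^s\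 \forall i\in\mathcal{V}^{\mathrm{eq}}.$$ Here $f_i:\mathbb{R}^{d_i}\to\mathbb{R}$, $h_i:\mathbb{R}^{d_i}\to\mathbb{R}\cup\{+\infty\}$, $g_i:\mathbb{R}^{d_i}\to\mathbb{R}^{\tilde p}$, $A_i\in\mathbb{R}^{\tilde m\times d_i}$, $b_i\in\mathbb{R}^{\tilde m}$, $g_{ij}^s:\mathbb{R}^{d_j}\to\mathbb{R}^{p_i}$, $A_{ij}^s\in\mathbb{R}^{m_i\times d_j}$, $b_i^s\in\mathbb{R}^{m_i}$; $\mathcal{V}^{\mathrm{in}},\mathcal{V}^{\mathrm{eq}}\subseteq\mathcal{V}$ (possibly empty), $S_i^{\mathrm{in}},S_i^{\mathrm{eq}}$ are proper subsets of $\mathcal{V}$, with $S_i^{\mathrm{in}}=\emptyset$ for $i\notin\mathcal{V}^{\mathrm{in}}$ and $S_i^{\mathrm{eq}}=\emptyset$ for $i\notin\mathcal{V}^{\mathrm{eq}}$. $\tilde p,\tilde m$ may be $0$ (the corresponding constraints are then absent); at least one constraint is present. Graph. For $i\in\mathcal{V}$ let $\mathcal{N}_i^s=\{j\in\mathcal{V}\setminus\{i\}: j\in S_i^{\mathrm{in}}\cup S_i^{\mathrm{eq}}\text{ or }i\in S_j^{\mathrm{in}}\cup S_j^{\mathrm{eq}}\}$ and $\mathcal{E}^s=\{\{i,j\}: i\in\mathcal{V},j\in\mathcal{N}_i^s\}$. $\mathcal{G}=(\mathcal{V},\mathcal{E})$ is an undirected graph: if $\mathcal{V}^{\mathrm{in}}=\mathcal{V}^{\mathrm{eq}}=\emptyset$,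 any connected graph; if $\tilde m=\tilde p=0$, $\mathcal{E}=\mathcal{E}^s$; otherwise $\mathcal{E}=\mathcal{E}^s$ if $(\mathcal{V},\mathcal{E}^s)$ is connected, else $\mathcal{E}$ is $\mathcal{E}^s$ plus added links making the graph connected. $\mathcal{N}_i=\{j:\{i,j\}\in\mathcal{E}\}$. Algorithm D (distributed IPLUX). Node $i$ keeps $x_i(k)\in\mathbb{R}^{d_i}$, $t_i(k)\in\mathbb{R}^{\tilde p}$, $v_i^x(k)\in\mathbb{R}^{d_i}$, $u_i(k)=[(u_i^x(k))^T,(u_i^t(k))^T]^T$ and $z_i(k)=[(z_i^x(k))^T,(z_i^t(k))^T]^T$ in $\mathbb{R}^{\tilde m+\tilde p}$ (blocks of sizes $\tilde m,\tilde p$), $q_i(k)$, and $r_i(k)=\sum_{j\in\mathcal{V}^{\mathrm{eq}}:i\in S_j^{\mathrm{eq}}}(A_{ji}^s)^T\bigl(\sum_{\ell\in S_j^{\mathrm{eq}}}A_{j\ell}^sx_\ell(k)-b_j^s\bigr)$; $s_i'(k)=g_i(x_i(k))-t_i(k)$; $s_i''(k)=\sum_{j\in S_i^{\mathrm{in}}}g_{ij}^s(x_j(k))$ for $i\in\mathcal{V}^{\mathrm{in}}$; $s_i(k)=[(s_i'(k))^T,(s_i''(k))^T]^T$ if $i\in\mathcal{V}^{\mathrm{in}}$ and $s_i(k)=s_i'(k)$ otherwise. Likewise $q_i(k)=[(q_i'(k))^T,(q_i''(k))^T]^T$ (blocks of sizes $\tilde p,p_i$) if $i\in\mathcal{V}^{\mathrm{in}}$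 and $q_i(k)=q_i'(k)\in\mathbb{R}^{\tilde p}$ otherwise. Initialization: $v_i^x(0)=\mathbf{0}$; $x_i(0)\in\operatorname{dom}(h_i)$, $t_i(0)$, $u_i(0)$ arbitrary; $z_i(0)=\rho\sum_{j\in\mathcal{N}_i\cup\{i\}}[P^H]_{ij}u_j(0)$; $q_i(0)=\max\{-s_i(0),\mathbf{0}\}$. For $k\ge0$ and all $i\in\mathcal{V}$: $x_i(k+1)=\arg\min_{x_i\in\mathbb{R}^{d_i}}\mathcal{L}_i^k(x_i)$ with $\mathcal{L}_i^k(x_i)=\langle\nabla f_i(x_i(k)),x_i-x_i(k)\rangle+h_i(x_i)+\langle v_i^x(k),x_i\rangle+\frac{\gamma\lambda^2}{2}\|x_i-x_i(k)+\frac1{\lambda^2}r_i(k)\|^2+\frac1{2\rho}\|A_ix_i-b_i\|^2+\langle(\sum_{j\in\mathcal{N}_i\cup\{i\}}[P^W]_{ij}u_j^x(k))-\frac1\rho z_i^x(k),A_ix_i-b_i\rangle+\langle q_i'(k)+s_i'(k),g_i(x_i)\rangle+\sum_{j\in\mathcal{V}^{\mathrm{in}}:i\in S_j^{\mathrm{in}}}\langle q_j''(k)+s_j''(k),g_{ji}^s(x_i)\rangle+\frac\alpha2\|x_i-x_i(k)\|^2$; $t_i(k+1)=\frac{1}{1/\rho+\gamma\lambda^2+\alpha}\Bigl((\gamma\lambda^2+\alpha)t_i(k)-\sum_{j\in\mathcal{N}_i\cup\{i\}}[P^W]_{ij}u_j^t(k)+\frac1\rho z_i^t(k)+q_i'(k)+s_i'(k)\Bigr)$;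 $v_i^x(k+1)=v_i^x(k)+\gamma r_i(k+1)$; $u_i(k+1)=\frac1\rho(B_iy_i(k+1)-c_i-z_i(k))+\sum_{j\in\mathcal{N}_i\cup\{i\}}[P^W]_{ij}u_j(k)$, where $y_i(k)=[x_i(k)^T,t_i(k)^T]^T$, $B_i=\operatorname{diag}(A_i,I_{\tilde p})$, $c_i=[b_i^T,\mathbf{0}_{\tilde p}^T]^T$; $q_i(k+1)=\max\{-s_i(k+1),q_i(k)+s_i(k+1)\}$; $z_i(k+1)=z_i(k)+\rho\sum_{j\in\mathcal{N}_i\cup\{i\}}[P^H]_{ij}u_j(k+1)$. Stacked iterates: $\mathbf{y}(k)=[y_1(k)^T,\dots,y_n(k)^T]^T$, and similarly $\mathbf{u}(k),\mathbf{z}(k),\mathbf{q}(k)$; $\mathbf{v}(k)=[v_1(k)^T,\dots,v_n(k)^T]^T$ with $v_i(k)=[v_i^x(k)^T,\mathbf{0}_{\tilde p}^T]^T$ (so $\mathbf{v}(0)=\mathbf{0}$). Reformulated problem (R). For $\mathbf{y}=[y_1^T,\dots,y_n^T]^T\in\mathbb{R}^N$, $y_i=[x_i^T,t_i^T]^T$, $N=n\tilde p+\sum_id_i$: $\Phi(\mathbf{y})=\sum_i(f_i(x_i)+h_i(x_i))$; $G_i(\mathbf{y})$ is $g_i(x_i)-t_i$ stacked over $\sum_{j\in S_i^{\mathrm{in}}}g_{ij}^s(x_j)$ if $i\in\mathcal{V}^{\mathrm{in}}$, and $g_i(x_i)-t_i$ otherwise; $\mathbf{G}=[G_1^T,\dots,G_n^T]^T$;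 $\mathbf{B}=\operatorname{diag}(B_1,\dots,B_n)$, $\mathbf{c}=[c_1^T,\dots,c_n^T]^T$. For $i\in\mathcal{V}^{\mathrm{eq}}$, $B_i^s=[B_{i1}^s,\dots,B_{in}^s]$ with $B_{ij}^s=[A_{ij}^s,\mathbf{O}_{m_i\times\tilde p}]$ if $j\in S_i^{\mathrm{eq}}$ and $\mathbf{O}$ otherwise; $\mathbf{B}^s,\mathbf{c}^s$ stack $B_i^s,b_i^s$ over $i\in\mathcal{V}^{\mathrm{eq}}$. Problem (R): minimize $\Phi(\mathbf{y})$ over $\mathbf{y}\in\mathbb{R}^N$ subject to $\mathbf{G}(\mathbf{y})\le\mathbf{0}$, $(\mathbf{1}_n\otimes I_{\tilde m+\tilde p})^T(\mathbf{B}\mathbf{y}-\mathbf{c})=\mathbf{0}$, $\mathbf{B}^s\mathbf{y}=\mathbf{c}^s$. Let $\mathbf{y}^\star$ be an optimal solution of (R), $\mathbf{z}^\star=\mathbf{B}\mathbf{y}^\star-\mathbf{c}$, and let $(\mathbf{q}^\star,u^\star,\tilde{\mathbf{v}}^\star)$ be a geometric multiplier for (R), i.e. $\mathbf{q}^\star\ge\mathbf{0}$ and $\Phi(\mathbf{y}^\star)=\min_{\mathbf{y}}\Phi(\mathbf{y})+\langle\mathbf{q}^\star,\mathbf{G}(\mathbf{y})\rangle+\langle u^\star,(\mathbf{1}_n\otimes I_{\tilde m+\tilde p})^T(\mathbf{B}\mathbf{y}-\mathbf{c})\rangle+\langle\tilde{\mathbf{v}}^\star,\mathbf{B}^s\mathbf{y}-\mathbf{c}^s\rangle$.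 Constants. With $W=P^W\otimes I_{\tilde m+\tilde p}$, $H=P^H\otimes I_{\tilde m+\tilde p}$, $M^\dag=((\mathbf{B}^s)^T\mathbf{B}^s)^\dag$: $R(0)=\frac{1}{2\rho}\|\mathbf{z}(0)-\mathbf{z}^\star\|_{H^\dag}^2+\frac\rho2\|\mathbf{u}(0)\|_W^2+\frac{1}{2\gamma}\|\mathbf{v}(0)\|_{M^\dag}^2+\frac{\gamma\lambda^2+\alpha}{2}\|\mathbf{y}(0)-\mathbf{y}^\star\|^2+\frac12\|\mathbf{q}(0)\|^2-\frac12\|\mathbf{G}(\mathbf{y}(0))\|^2$; $C=R(0)+\rho\sqrt n\|u^\star\|\|\mathbf{u}(0)\|_W+\frac1\gamma\|\tilde{\mathbf{v}}^\star\|\|\mathbf{v}(0)\|_{M^\dag}+\frac{\rho n}{2}\|u^\star\|^2+\frac1{2\gamma}\|\tilde{\mathbf{v}}^\star\|^2+\|\mathbf{q}^\star\|^2+\frac12\|\mathbf{G}(\mathbf{y}^\star)\|^2$; $V_{\mathbf{q}}=2(\|\mathbf{q}^\star\|+\sqrt C)$; $V_{\mathbf{u}}=\sqrt n(\|\mathbf{u}(0)\|_W+\sqrt n\|u^\star\|+\sqrt{2C/\rho})$; $V_{\mathbf{v}}=\|\mathbf{v}(0)\|_{M^\dag}+\|\tilde{\mathbf{v}}^\star\|+\sqrt{2\gamma C}$; $R_\Phi=V_{\mathbf{q}}\mathbf{1}^T\mathbf{q}^\star+\rho V_{\mathbf{u}}\|u^\star\|+V_{\mathbf{v}}\|\tilde{\mathbf{v}}^\star\|/\gamma$;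 $R_\Phi'=R(0)$. *)

(* Defs.v *)
From HB Require Import structures.
From mathcomp Require Import all_boot all_order all_algebra.
From mathcomp Require Import all_classical all_reals all_analysis.

Set Implicit Arguments.
Unset Strict Implicit.
Unset Printing Implicit Defensive.

Import Order.TTheory GRing.Theory Num.Theory.
Import numFieldNormedType.Exports.

Local Open Scope classical_set_scope.
Local Open Scope ring_scope.

Section Euclidean.
Context {R : realType}.

Definition dot r (u v : 'cV[R]_r) : R := (u^T *m v) 0 0.

(* The library norm on matrices is the max norm, so the Euclidean norm is
   introduced separately. *)
Definition enorm r (v : 'cV[R]_r) : R := Num.sqrt (dot v v).

Definition wnorm r (A : 'M[R]_r) (v : 'cV[R]_r) : R :=
  Num.sqrt ((v^T *m A *m v) 0 0).

Definition spectral_norm r s (A : 'M[R]_(r, s)) : R :=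
  sup [set enorm (A *m x) | x in [set x : 'cV[R]_s | enorm x <= 1]].

Definition psd r (A : 'M[R]_r) : Prop :=
  A^T = A /\ forall x : 'cV[R]_r, 0 <= (x^T *m A *m x) 0 0.

Definition is_mpinv r s (A : 'M[R]_(r, s)) (X : 'M[R]_(s, r)) : Prop :=
  [/\ A *m X *m A = A, X *m A *m X = X,
      (A *m X)^T = A *m X & (X *m A)^T = X *m A].

(* Moore-Penrose inverse; see mpinvP and mpinv_uniq. The library's pinvmx is
   only a partial inverse. *)
Definition mpinv r s (A : 'M[R]_(r, s)) : 'M[R]_(s, r) :=
  xget 0 [set X | is_mpinv A X].

Definition vmax r (u v : 'cV[R]_r) : 'cV[R]_r := map2_mx Num.max u v.

Definition vle r (u v : 'cV[R]_r) : Prop := forall a, u a 0 <= v a 0.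
Definition vlt r (u v : 'cV[R]_r) : Prop := forall a, u a 0 < v a 0.

Definition grad r (f : 'cV[R]_r -> R) (x : 'cV[R]_r) : 'cV[R]_r :=
  \col_a 'd (f : 'cV[R]_r -> R^o) x (delta_mx a 0).

Definition lip_on r s (D : set 'cV[R]_r) (K : R) (F : 'cV[R]_r -> 'cV[R]_s) :=
  forall x y, D x -> D y -> enorm (F x - F y) <= K * enorm (x - y).

Definition convex_vfunction r s (D : set 'cV[R]_r)
    (F : 'cV[R]_r -> 'cV[R]_s) : Prop :=
  forall a, convex_function (E := 'cV[R]_r) D (fun x => F x a 0).

Definition affine_hull r (D : set 'cV[R]_r) : set 'cV[R]_r :=
  [set y | exists (k : nat) (c : 'I_k -> R) (w : 'I_k -> 'cV[R]_r),
     [/\ forall i, D (w i), \sum_i c i = 1 & y = \sum_i c i *: w i]].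

Definition rel_interior r (D : set 'cV[R]_r) : set 'cV[R]_r :=
  [set x | D x /\ exists2 eps : R, 0 < eps &
     forall y, affine_hull D y -> enorm (y - x) < eps -> D y].

Lemma dotE r (u v : 'cV[R]_r) : dot u v = \sum_a u a 0 * v a 0.
Proof. by rewrite /dot mxE; apply: eq_bigr => a _; rewrite mxE. Qed.

Lemma dotvv_eq0 r (v : 'cV[R]_r) : dot v v = 0 -> v = 0.
Proof.
rewrite dotE => /eqP; rewrite psumr_eq0 => [/allP v0|a _]; last first.
  by rewrite -expr2 sqr_ge0.
apply/colP => a; have := v0 a (mem_index_enum _).
by rewrite mulf_eq0 orbb mxE => /eqP.
Qed.

Lemma row_free_gram r s (F : 'M[R]_(r, s)) :
  row_free F -> F *m F^T \in unitmx.
Proof.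
move=> Ffree; rewrite -row_free_unit -kermx_eq0; apply/eqP/row_matrixP => i.
rewrite row0; set v := row i _.
have vFF : v *m (F *m F^T) = 0 by apply/sub_kermxP; exact: row_sub.
have vF0 : (v *m F)^T = 0.
  apply: dotvv_eq0; rewrite /dot trmxK trmx_mul mulmxA -[v *m F *m F^T]mulmxA.
  by rewrite vFF mul0mx mxE.
have vF : v *m F = 0 by rewrite -[LHS]trmxK vF0 trmx0.
by apply: (row_free_inj Ffree); rewrite mul0mx.
Qed.

Lemma mpinv_ex r s (A : 'M[R]_(r, s)) : exists X, is_mpinv A X.
Proof.
have [k [C [F [AE Cfree Ffree]]]] : exists (k : nat)
      (C : 'M[R]_(r, k)) (F : 'M[R]_(k, s)),
    [/\ A = C *m F, row_free C^T & row_free F].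
  exists (\rank A), (col_base A), (row_base A).
  rewrite mulmx_base row_base_free; split => //.
  by rewrite /row_free mxrank_tr; exact: col_base_full.
have uF := row_free_gram Ffree; have := row_free_gram Cfree; rewrite trmxK => uC.
pose X := F^T *m invmx (F *m F^T) *m invmx (C^T *m C) *m C^T.
have AX : A *m X = C *m invmx (C^T *m C) *m C^T.
  rewrite /X AE !mulmxA -(mulmxA C F F^T).
  by rewrite -(mulmxA C _ (invmx _)) mulmxV// mulmx1.
have XA : X *m A = F^T *m invmx (F *m F^T) *m F.
  rewrite /X AE !mulmxA -(mulmxA _ C^T C).
  by rewrite -(mulmxA _ (invmx (C^T *m C))) mulVmx// mulmx1.
exists X; split.
- rewrite AX AE mulmxA -(mulmxA _ C^T C).
  by rewrite -(mulmxA C) mulVmx// mulmx1.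
- rewrite XA /X !mulmxA -(mulmxA _ F F^T).
  by rewrite -(mulmxA F^T) mulVmx// mulmx1.
- by rewrite AX !trmx_mul trmx_inv trmx_mul !trmxK mulmxA.
- by rewrite XA !trmx_mul trmx_inv trmx_mul !trmxK mulmxA.
Qed.

Lemma mpinvP r s (A : 'M[R]_(r, s)) : is_mpinv A (mpinv A).
Proof. by have [X AX] := mpinv_ex A; exact: (xgetPex 0 (ex_intro _ X AX)). Qed.

Lemma mpinv_uniq r s (A : 'M[R]_(r, s)) X Y :
  is_mpinv A X -> is_mpinv A Y -> X = Y.
Proof.
move=> [AXA XAX AXt XAt] [AYA YAY AYt YAt].
have AXY : A *m X = A *m Y.
  rewrite -AXt -{1}AYA -(mulmxA (A *m Y)) trmx_mul AXt AYt.
  by rewrite mulmxA AXA.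
have XAY : X *m A = Y *m A.
  rewrite -XAt -{1}AYA -(mulmxA A) mulmxA trmx_mul XAt YAt.
  by rewrite -mulmxA [A *m (X *m A)]mulmxA AXA.
by rewrite -XAX XAY -mulmxA AXY mulmxA YAY.
Qed.

End Euclidean.

(* Data of the coupled problem over the node set 'I_n. [ps i] and [ms i] are
   the numbers of sparse inequality and equality constraints of node i; see
   [well_formed] for their value outside [Vin] and [Veq]. *)
Record problem (R : realType) (n : nat) := Problem {
  dx : 'I_n -> nat;
  pt : nat;
  mt : nat;
  ps : 'I_n -> nat;
  ms : 'I_n -> nat;
  Vin : {set 'I_n};
  Veq : {set 'I_n};
  Sin : 'I_n -> {set 'I_n};
  Seq : 'I_n -> {set 'I_n};
  fo : forall i, 'cV[R]_(dx i) -> R;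
  ho : forall i, 'cV[R]_(dx i) -> \bar R;
  gc : forall i, 'cV[R]_(dx i) -> 'cV[R]_pt;
  Ac : forall i, 'M[R]_(mt, dx i);
  bc : 'I_n -> 'cV[R]_mt;
  gs : forall i j, 'cV[R]_(dx j) -> 'cV[R]_(ps i);
  As : forall i j, 'M[R]_(ms i, dx j);
  bs : forall i, 'cV[R]_(ms i)
}.

Arguments fo {R n} P i x : rename.
Arguments ho {R n} P i x : rename.
Arguments gc {R n} P i x : rename.
Arguments gs {R n} P i j x : rename.

Section Problem.
Context {R : realType} {n : nat} (P : problem R n).

(* A node outside [Vin] (resp. [Veq]) has no sparse constraint; giving it a
   zero-dimensional block makes [s'; s''] equal to s' there, and lets the
   stacks over [Vin] and [Veq] be written as stacks over all nodes. *)
Record well_formed : Prop := WellFormed {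
  wf_n : (0 < n)%N;
  wf_ho : forall i x, ho P i x != -oo%E;
  wf_Sin : forall i, Sin P i \proper [set: 'I_n]%SET;
  wf_Seq : forall i, Seq P i \proper [set: 'I_n]%SET;
  wf_Sin0 : forall i, i \notin Vin P -> Sin P i = finset.set0;
  wf_Seq0 : forall i, i \notin Veq P -> Seq P i = finset.set0;
  wf_ps : forall i, i \notin Vin P -> ps P i = 0%N;
  wf_ms : forall i, i \notin Veq P -> ms P i = 0%N;
  wf_constraint :
    [|| 0 < pt P, 0 < mt P, Vin P != finset.set0 | Veq P != finset.set0]%N
}.

Definition dom (i : 'I_n) : set 'cV[R]_(dx P i) := [set x | (ho P i x < +oo)%E].
Arguments dom : clear implicits.

Definition Fo i (x : 'cV[R]_(dx P i)) : \bar R := ((fo P i x)%:E + ho P i x)%E.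

Definition sparse_in (x : forall i, 'cV[R]_(dx P i)) i : 'cV[R]_(ps P i) :=
  \sum_(j in Sin P i) gs P i j (x j).

Definition sparse_eq (x : forall i, 'cV[R]_(dx P i)) i : 'cV[R]_(ms P i) :=
  \sum_(j in Seq P i) As P i j *m x j.

Definition feasible (x : forall i, 'cV[R]_(dx P i)) : Prop :=
  [/\ vle (\sum_i gc P i (x i)) 0,
      \sum_i Ac P i *m x i = \sum_i bc P i,
      forall i, i \in Vin P -> vle (sparse_in x i) 0 &
      forall i, i \in Veq P -> sparse_eq x i = bs P i].

Definition optimal (x : forall i, 'cV[R]_(dx P i)) : Prop :=
  feasible x /\ forall x', feasible x' ->
    (\sum_(i < n) Fo (x i) <= \sum_(i < n) Fo (x' i))%E.

Definition slater (x : forall i, 'cV[R]_(dx P i)) : Prop :=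
  (forall i, rel_interior (dom i) (x i)) /\
  [/\ vlt (\sum_i gc P i (x i)) 0,
      \sum_i Ac P i *m x i = \sum_i bc P i,
      forall i, i \in Vin P -> vlt (sparse_in x i) 0 &
      forall i, i \in Veq P -> sparse_eq x i = bs P i].

Definition sparse_edge : rel 'I_n := fun i j =>
  (i != j) &&
  ((j \in Sin P i :|: Seq P i)%SET || (i \in Sin P j :|: Seq P j)%SET).

Definition graph_connected (e : rel 'I_n) : bool :=
  [forall i, forall j, connect e i j].

Definition comm_graph (e : rel 'I_n) : Prop :=
  [/\ symmetric e, irreflexive e &
   if (Vin P == finset.set0) && (Veq P == finset.set0)
   then is_true (graph_connected e)
   else if (mt P == 0%N) && (pt P == 0%N) then e =2 sparse_edge
   else if graph_connected sparse_edge then e =2 sparse_edge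
   else subrel sparse_edge e /\ graph_connected e].

(* N_i together with i itself *)
Definition nbhd (e : rel 'I_n) (i : 'I_n) : {set 'I_n} :=
  [set j | (j == i) || e i j]%SET.

Definition ydim := (\sum_(i < n) (dx P i + pt P))%N.
Definition udim := (\sum_(i < n) (mt P + pt P))%N.
Definition qdim := (\sum_(i < n) (pt P + ps P i))%N.
Definition vdim := (\sum_(i < n) ms P i)%N.

Definition stack (x : forall i, 'cV[R]_(dx P i)) (t : 'I_n -> 'cV[R]_(pt P)) :
  'cV[R]_ydim := \mxcol_(i < n) col_mx (x i) (t i).

Definition yblock (y : 'cV[R]_ydim) (i : 'I_n) : 'cV[R]_(dx P i + pt P) :=
  @submxcol R n (fun i => dx P i + pt P)%N 1 y i.
Definition xpart (y : 'cV[R]_ydim) i : 'cV[R]_(dx P i) := usubmx (yblock y i).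
Definition tpart (y : 'cV[R]_ydim) i : 'cV[R]_(pt P) := dsubmx (yblock y i).

Definition Phi (y : 'cV[R]_ydim) : \bar R := (\sum_(i < n) Fo (xpart y i))%E.

Definition Gi (x : forall i, 'cV[R]_(dx P i)) (t : 'I_n -> 'cV[R]_(pt P)) i :
  'cV[R]_(pt P + ps P i) := col_mx (gc P i (x i) - t i) (sparse_in x i).

Definition G (y : 'cV[R]_ydim) : 'cV[R]_qdim :=
  \mxcol_(i < n) Gi (xpart y) (tpart y) i.

Definition Bi i : 'M[R]_(mt P + pt P, dx P i + pt P) :=
  block_mx (Ac P i) 0 0 1%:M.
Definition ci i : 'cV[R]_(mt P + pt P) := col_mx (bc P i) 0.

(* Block diagonal of rectangular blocks; the library's mxdiag only takes
   square ones. *)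
Definition B : 'M[R]_(udim, ydim) :=
  \mxblock_(i < n, j < n) (if i == j then Bi j else 0).
Definition c : 'cV[R]_udim := \mxcol_(i < n) ci i.

Definition Bs : 'M[R]_(vdim, ydim) :=
  \mxblock_(i < n, j < n)
    (if j \in Seq P i then row_mx (As P i j) (0 : 'M[R]_(ms P i, pt P)) else 0).
Definition cs : 'cV[R]_vdim := \mxcol_(i < n) bs P i.

(* Q (x) I_(mt + pt) and 1_n (x) I_(mt + pt) *)
Definition kronI (Q : 'M[R]_n) : 'M[R]_udim :=
  \mxblock_(i < n, j < n) ((Q i j)%:M : 'M[R]_(mt P + pt P)).
Definition ones_kronI : 'M[R]_(udim, mt P + pt P) :=
  \mxcol_(i < n) (1%:M : 'M[R]_(mt P + pt P)).

Definition feasibleR (y : 'cV[R]_ydim) : Prop :=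
  [/\ vle (G y) 0, ones_kronI^T *m (B *m y - c) = 0 & Bs *m y = cs].

Definition optimalR (y : 'cV[R]_ydim) : Prop :=
  feasibleR y /\ forall y', feasibleR y' -> (Phi y <= Phi y')%E.

Definition lagrangian (q : 'cV[R]_qdim) (u : 'cV[R]_(mt P + pt P))
    (v : 'cV[R]_vdim) (y : 'cV[R]_ydim) : \bar R :=
  (Phi y + (dot q (G y) + dot u (ones_kronI^T *m (B *m y - c))
            + dot v (Bs *m y - cs))%:E)%E.

Definition geometric_multiplier (ystar : 'cV[R]_ydim) (q : 'cV[R]_qdim)
    (u : 'cV[R]_(mt P + pt P)) (v : 'cV[R]_vdim) : Prop :=
  [/\ vle 0 q, exists y, lagrangian q u v y = Phi ystar &
      forall y, (Phi ystar <= lagrangian q u v y)%E].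

Definition Lconst (Lg Lgs : R) : R :=
  Num.sqrt ((\max_(i < n) \sum_(j in Vin P | i \in Sin P j) #|Sin P j|)%N%:R
              * Lgs ^+ 2 + 1 + Lg ^+ 2).

Record iterates := Iterates {
  xk : nat -> forall i, 'cV[R]_(dx P i);
  tk : nat -> 'I_n -> 'cV[R]_(pt P);
  vxk : nat -> forall i, 'cV[R]_(dx P i);
  uk : nat -> 'I_n -> 'cV[R]_(mt P + pt P);
  zk : nat -> 'I_n -> 'cV[R]_(mt P + pt P);
  qk : nat -> forall i, 'cV[R]_(pt P + ps P i)
}.

Section Algorithm.
Context (e : rel 'I_n) (PW PH : 'M[R]_n) (gamma lambda rho alpha : R).
Context (it : iterates).

Definition sk k i : 'cV[R]_(pt P + ps P i) := Gi (xk it k) (tk it k) i.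

Definition rk k i : 'cV[R]_(dx P i) :=
  \sum_(j in Veq P | i \in Seq P j)
    (As P j i)^T *m (sparse_eq (xk it k) j - bs P j).

Definition Wu k i : 'cV[R]_(mt P + pt P) :=
  \sum_(j in nbhd e i) PW i j *: uk it k j.
Definition Hu k i : 'cV[R]_(mt P + pt P) :=
  \sum_(j in nbhd e i) PH i j *: uk it k j.

Definition local_objective k i (x : 'cV[R]_(dx P i)) : \bar R :=
  let xi := xk it k i in
  ((dot (grad (fo P i) xi) (x - xi)
    + dot (vxk it k i) x
    + gamma * lambda ^+ 2 / 2
        * enorm (x - xi + (lambda ^+ 2)^-1 *: rk k i) ^+ 2
    + (2 * rho)^-1 * enorm (Ac P i *m x - bc P i) ^+ 2
    + dot (usubmx (Wu k i) - rho^-1 *: usubmx (zk it k i))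
          (Ac P i *m x - bc P i)
    + dot (usubmx (qk it k i) + usubmx (sk k i)) (gc P i x)
    + \sum_(j in Vin P | i \in Sin P j)
        dot (dsubmx (qk it k j) + dsubmx (sk k j)) (gs P j i x)
    + alpha / 2 * enorm (x - xi) ^+ 2)%:E
   + ho P i x)%E.
Arguments local_objective : clear implicits.

Record iplux_run : Prop := IpluxRun {
  init_vx : forall i, vxk it 0%N i = 0;
  init_x : forall i, dom i (xk it 0%N i);
  init_z : forall i, zk it 0%N i = rho *: Hu 0%N i;
  init_q : forall i, qk it 0%N i = vmax (- sk 0%N i) 0;
  step_x : forall k i x,
    (local_objective k i (xk it k.+1 i) <= local_objective k i x)%E;
  step_t : forall k i, tk it k.+1 i =
    (rho^-1 + gamma * lambda ^+ 2 + alpha)^-1 *: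
      ((gamma * lambda ^+ 2 + alpha) *: tk it k i - dsubmx (Wu k i)
       + rho^-1 *: dsubmx (zk it k i) + usubmx (qk it k i) + usubmx (sk k i));
  step_vx : forall k i, vxk it k.+1 i = vxk it k i + gamma *: rk k.+1 i;
  step_u : forall k i, uk it k.+1 i =
    rho^-1 *: (Bi i *m col_mx (xk it k.+1 i) (tk it k.+1 i) - ci i - zk it k i)
    + Wu k i;
  step_q : forall k i,
    qk it k.+1 i = vmax (- sk k.+1 i) (qk it k i + sk k.+1 i);
  step_z : forall k i, zk it k.+1 i = zk it k i + rho *: Hu k.+1 i
}.

Definition ystack k : 'cV[R]_ydim := stack (xk it k) (tk it k).
Definition vstack k : 'cV[R]_ydim := stack (vxk it k) (fun=> 0).
Definition ustack k : 'cV[R]_udim := \mxcol_(i < n) uk it k i.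
Definition zstack k : 'cV[R]_udim := \mxcol_(i < n) zk it k i.
Definition qstack k : 'cV[R]_qdim := \mxcol_(i < n) qk it k i.

Definition xbar k i : 'cV[R]_(dx P i) :=
  k%:R^-1 *: \sum_(1 <= l < k.+1) xk it l i.

Context (ystar : 'cV[R]_ydim) (qstar : 'cV[R]_qdim).
Context (ustar : 'cV[R]_(mt P + pt P)) (vstar : 'cV[R]_vdim).

Definition Mdag : 'M[R]_ydim := mpinv (Bs^T *m Bs).

Definition R0 : R :=
  (2 * rho)^-1
    * wnorm (mpinv (kronI PH)) (zstack 0 - (B *m ystar - c)) ^+ 2
  + rho / 2 * wnorm (kronI PW) (ustack 0) ^+ 2
  + (2 * gamma)^-1 * wnorm Mdag (vstack 0) ^+ 2
  + (gamma * lambda ^+ 2 + alpha) / 2 * enorm (ystack 0 - ystar) ^+ 2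
  + 2^-1 * enorm (qstack 0) ^+ 2 - 2^-1 * enorm (G (ystack 0)) ^+ 2.

Definition Cconst : R :=
  R0 + rho * Num.sqrt n%:R * enorm ustar * wnorm (kronI PW) (ustack 0)
  + gamma^-1 * enorm vstar * wnorm Mdag (vstack 0)
  + rho * n%:R / 2 * enorm ustar ^+ 2
  + (2 * gamma)^-1 * enorm vstar ^+ 2
  + enorm qstar ^+ 2 + 2^-1 * enorm (G ystar) ^+ 2.

Definition Vq : R := 2 * (enorm qstar + Num.sqrt Cconst).

Definition Vu : R :=
  Num.sqrt n%:R * (wnorm (kronI PW) (ustack 0) + Num.sqrt n%:R * enorm ustar
                   + Num.sqrt (2 * Cconst / rho)).

Definition Vv : R :=
  wnorm Mdag (vstack 0) + enorm vstar + Num.sqrt (2 * gamma * Cconst).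

Definition RPhi : R :=
  Vq * dot (const_mx 1) qstar + rho * Vu * enorm ustar
  + Vv * enorm vstar / gamma.

End Algorithm.
End Problem.

Arguments dom {R n} P i _.
Arguments local_objective {R n} P e PW gamma lambda rho alpha it k i x.

(* Main.v *)
Require Import Defs.
From mathcomp Require Import all_boot all_order all_algebra.
From mathcomp Require Import all_classical all_reals all_analysis.
From mathcomp Require Import ring lra.
Import Order.TTheory GRing.Theory Num.Theory.
Import numFieldNormedType.Exports.
Local Open Scope classical_set_scope.
Local Open Scope ring_scope.
Set Implicit Arguments.
Unset Strict Implicit.
Unset Printing Implicit Defensive.

(** The proof is an energy argument. Write [y k] for the stacked iterates, [s k]
    for the constraint values [G (y k)], [e k] for the residual of the sparse
    equalities, and [w k = gamma * (e 1 + ... + e k)]. The local variables [v_i]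
    are then the image of [w k] under the transpose of the sparse constraint
    matrix ([vxkE]), so one iteration is a linearized proximal method of
    multipliers for the sparse equalities, a consensus step on [u] and [z] for
    the coupled equalities, and a virtual queue [q] for the inequalities.

    Each node minimizes a convex function plus a quadratic one. Its first-order
    condition ([prox_optimality]), the descent lemma and the gradient inequality
    for [f_i], summed over the nodes, bound the objective at [y (k + 1)] by its
    value at any point of the domain that satisfies the sparse equalities, plus
    inner products of consecutive iterates ([primal_step]). Taking that point to be the optimum, each inner product is
    the difference of two consecutive squares, up to remainders
    ([inertia_step], [multiplier_step], [queue_step], [consensus_step]). The
    spectral bound on [lambda], the Lipschitz bound [G_lipschitz] and the choice
    of [alpha] make the total quadratic term in [y (k + 1) - y k] nonpositive,
    hence [energy_step]: the optimality gap is at most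
    [energy k - energy (k + 1)]. At time 0 the energy is the constant [R0].

    Summing bounds the accumulated gap from above by [R0]. From below, the
    geometric multiplier bounds it by an expression linear in the dual
    iterates, because the accumulated residuals are dual iterates: [s] sums to
    at most [q k], [e] sums to [w k / gamma], and the equality residual summed
    over the nodes telescopes to a difference of values of [u]. Since the energy is quadratic
    in these same variables, completing the squares bounds them uniformly in
    [k] ([dual_squares_le]). The accumulated residuals are therefore bounded,
    and Jensen's inequality turns this into the [1 / k] rates for the averaged
    iterates ([averaged_rates]); the lower bound on the objective is the
    multiplier inequality at the averaged point. *)

(** * Euclidean and weighted norms *)

Section EuclideanTheory.
Context {R : realType}.

Lemma dotC r (u v : 'cV[R]_r) : dot u v = dot v u.
Proof. by rewrite !dotE; apply: eq_bigr => a _; rewrite mulrC. Qed.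

Lemma dotDl r (u v w : 'cV[R]_r) : dot (u + v) w = dot u w + dot v w.
Proof. by rewrite /dot linearD mulmxDl mxE. Qed.

Lemma dotDr r (u v w : 'cV[R]_r) : dot u (v + w) = dot u v + dot u w.
Proof. by rewrite /dot mulmxDr mxE. Qed.

Lemma dotZl r k (u v : 'cV[R]_r) : dot (k *: u) v = k * dot u v.
Proof. by rewrite /dot linearZ -scalemxAl mxE. Qed.

Lemma dotZr r k (u v : 'cV[R]_r) : dot u (k *: v) = k * dot u v.
Proof. by rewrite /dot -scalemxAr mxE. Qed.

Lemma dotNl r (u v : 'cV[R]_r) : dot (- u) v = - dot u v.
Proof. by rewrite -scaleN1r dotZl mulN1r. Qed.

Lemma dotNr r (u v : 'cV[R]_r) : dot u (- v) = - dot u v.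
Proof. by rewrite -scaleN1r dotZr mulN1r. Qed.

Lemma dotBl r (u v w : 'cV[R]_r) : dot (u - v) w = dot u w - dot v w.
Proof. by rewrite dotDl dotNl. Qed.

Lemma dotBr r (u v w : 'cV[R]_r) : dot u (v - w) = dot u v - dot u w.
Proof. by rewrite dotDr dotNr. Qed.

Lemma dot0l r (v : 'cV[R]_r) : dot 0 v = 0.
Proof. by rewrite /dot trmx0 mul0mx mxE. Qed.

Lemma dot0r r (v : 'cV[R]_r) : dot v 0 = 0.
Proof. by rewrite dotC dot0l. Qed.

Lemma dot_sumr r I (s : seq I) (p : pred I) (u : 'cV[R]_r) (F : I -> 'cV[R]_r) :
  dot u (\sum_(i <- s | p i) F i) = \sum_(i <- s | p i) dot u (F i).
Proof. by rewrite /dot mulmx_sumr summxE. Qed.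

Lemma dot_mull r s (A : 'M[R]_(r, s)) u v : dot (A *m u) v = dot u (A^T *m v).
Proof. by rewrite /dot trmx_mul mulmxA. Qed.

Lemma dot_mulr r s (A : 'M[R]_(r, s)) u v : dot u (A *m v) = dot (A^T *m u) v.
Proof. by rewrite dot_mull trmxK. Qed.

Definition dotlin := (dotDl, dotDr, dotNl, dotNr, dotZl, dotZr).

Lemma dotvv_ge0 r (v : 'cV[R]_r) : 0 <= dot v v.
Proof. by rewrite dotE sumr_ge0// => a _; rewrite -expr2 sqr_ge0. Qed.

Lemma enorm_ge0 r (v : 'cV[R]_r) : 0 <= enorm v.
Proof. exact: sqrtr_ge0. Qed.

Lemma sqr_enorm r (v : 'cV[R]_r) : enorm v ^+ 2 = dot v v.
Proof. by rewrite sqr_sqrtr ?dotvv_ge0. Qed.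

Lemma wnorm_ge0 r (A : 'M[R]_r) (v : 'cV[R]_r) : 0 <= wnorm A v.
Proof. exact: sqrtr_ge0. Qed.

Lemma wformE r (A : 'M[R]_r) (u v : 'cV[R]_r) :
  (u^T *m A *m v) 0 0 = dot u (A *m v).
Proof. by rewrite -mulmxA. Qed.

Lemma psd_form_ge0 r (A : 'M[R]_r) v : psd A -> 0 <= dot v (A *m v).
Proof. by case=> _ /(_ v); rewrite wformE. Qed.

Lemma sqr_wnorm r (A : 'M[R]_r) (v : 'cV[R]_r) :
  0 <= dot v (A *m v) -> wnorm A v ^+ 2 = dot v (A *m v).
Proof. by move=> v0; rewrite /wnorm sqr_sqrtr wformE. Qed.

Lemma psd_formC r (A : 'M[R]_r) u v :
  psd A -> dot u (A *m v) = dot v (A *m u).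
Proof. by case=> At _; rewrite dot_mulr At dotC. Qed.

Lemma discriminant_le (a b c : R) :
  (forall t, 0 <= a + 2 * t * b + t ^+ 2 * c) -> b ^+ 2 <= a * c.
Proof.
move=> pos; have a0 : 0 <= a by have := pos 0; rewrite expr0n !mulr0 !mul0r !addr0.
have [c0|c0|c0] := ltgtP c 0.
- (* A negative [c] would make the quadratic negative at one of [+-(d + 1)]. *)
  have cN0 : 0 < - c by rewrite oppr_gt0.
  set d := (a + 1) / - c; have dE : d * c = - (a + 1).
    by rewrite /d invrN mulrN mulNr divfK// lt_eqF.
  have d0 : 0 <= d by rewrite divr_ge0 ?ltW//; lra.
  have : 0 <= a + (d + 1) ^+ 2 * c.
    by have := pos (d + 1); have := pos (- (d + 1)); rewrite sqrrN; lra.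
  have : (d + 1) ^+ 2 * c = (d + 1) * (d * c) + d * c + c by ring.
  have : 0 <= d * (a + 1) by rewrite mulr_ge0//; lra.
  rewrite dE; lra.
- have := pos (- (b / c)); have bc : b / c * c = b by rewrite divfK// gt_eqF.
  move: (b / c) bc => t tc; rewrite sqrrN => p1.
  have : 0 <= a - t * b by rewrite -[b in t * b]tc; nra.
  move=> /(mulr_ge0 (ltW c0)); nra.
- have [->|b0] := eqVneq b 0; first by rewrite c0 expr0n mulr0.
  (* At this point the affine function equals [-1]. *)
  have := pos (- (a + 1) / (2 * b)); rewrite c0 mulr0 addr0.
  have -> : a + 2 * (- (a + 1) / (2 * b)) * b = - 1 by field.
  lra.
Qed.

(** Cauchy--Schwarz for the semi-inner product of a positive semidefinite
    matrix. *)
Lemma psd_form_le r (A : 'M[R]_r) u v : psd A ->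
  dot u (A *m v) <= wnorm A u * wnorm A v.
Proof.
move=> psdA; apply: le_trans (ler_norm _) _.
rewrite -ler_sqr ?nnegrE ?mulr_ge0 ?wnorm_ge0// real_normK ?num_real//.
rewrite exprMn !sqr_wnorm ?psd_form_ge0//; apply: discriminant_le => t.
have := psd_form_ge0 (u + t *: v) psdA.
rewrite mulmxDr -scalemxAr !dotlin (psd_formC v u psdA); lra.
Qed.

Lemma psd1 r : psd (1%:M : 'M[R]_r).
Proof. by split=> [|v]; [rewrite tr_scalar_mx|rewrite wformE mul1mx dotvv_ge0]. Qed.

Lemma wnorm1 r (v : 'cV[R]_r) : wnorm 1%:M v = enorm v.
Proof. by rewrite /wnorm wformE mul1mx. Qed.

Lemma dot_le r (u v : 'cV[R]_r) : dot u v <= enorm u * enorm v.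
Proof. by have := psd_form_le u v (psd1 r); rewrite mul1mx !wnorm1. Qed.

Lemma dot_geN r (u v : 'cV[R]_r) : - (enorm u * enorm v) <= dot u v.
Proof.
have := dot_le (- u) v; rewrite dotNl.
have -> : enorm (- u) = enorm u by rewrite /enorm dotNl dotNr opprK.
by rewrite lerNl.
Qed.

Lemma enorm_le_sqr r (v : 'cV[R]_r) a : 0 <= a -> dot v v <= a ^+ 2 -> enorm v <= a.
Proof. by move=> a0 va; rewrite -(@ler_sqr R) ?nnegrE ?enorm_ge0// sqr_enorm. Qed.

Lemma enormZ r k (v : 'cV[R]_r) : enorm (k *: v) = `|k| * enorm v.
Proof.
by rewrite /enorm dotZl dotZr mulrA -expr2 sqrtrM ?sqr_ge0// sqrtr_sqr.
Qed.

Lemma coord_le_enorm r (v : 'cV[R]_r) a : `|v a 0| <= enorm v.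
Proof.
rewrite -(@ler_sqr R) ?nnegrE ?enorm_ge0// sqr_enorm dotE (bigD1 a)//=.
rewrite real_normK ?num_real// -expr2 lerDl sumr_ge0// => b _.
by rewrite -expr2 sqr_ge0.
Qed.

(** The Frobenius norm bounds the image of the unit ball, so the supremum
    defining the spectral norm is taken over a bounded set and dominates each
    of its members; a general vector is rescaled into the unit ball. *)
Lemma spectral_norm_bound r s (A : 'M[R]_(r, s)) x :
  enorm (A *m x) <= spectral_norm A * enorm x.
Proof.
set S := [set enorm (A *m z) | z in [set z : 'cV[R]_s | enorm z <= 1]].
have supS : has_sup S.
  split; first by exists (enorm (A *m 0)), 0 => //=; rewrite /enorm dot0l sqrtr0.
  exists (Num.sqrt (\sum_a dot (row a A)^T (row a A)^T)) => _ [z /= z1 <-].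
  apply: ler_wsqrtr; rewrite dotE; apply: ler_sum => a _.
  have -> : (A *m z) a 0 = dot (row a A)^T z.
    by rewrite /dot trmxK -row_mul [RHS]mxE.
  rewrite -expr2 -sqr_enorm -(@real_normK _ (dot _ z)) ?num_real//.
  rewrite ler_sqr ?nnegrE ?normr_ge0 ?enorm_ge0//.
  have := dot_le (row a A)^T z; have := dot_geN (row a A)^T z.
  have : enorm (row a A)^T * enorm z <= enorm (row a A)^T.
    by rewrite ler_piMr ?enorm_ge0.
  by move=> e1 e2 e3; rewrite ler_norml; apply/andP; split; lra.
have [x0|x0] := eqVneq (enorm x) 0.
  have -> : x = 0 by apply: dotvv_eq0; rewrite -sqr_enorm x0 expr0n.
  by rewrite mulmx0 /enorm !dot0l sqrtr0 mulr0.
have xp : 0 < enorm x by rewrite lt_def x0 enorm_ge0.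
rewrite -ler_pdivrMr// mulrC.
have <- : enorm (A *m ((enorm x)^-1 *: x)) = (enorm x)^-1 * enorm (A *m x).
  by rewrite -scalemxAr enormZ ger0_norm ?invr_ge0 ?enorm_ge0.
apply: ub_le_sup; first by case: supS.
exists ((enorm x)^-1 *: x) => //=.
by rewrite enormZ ger0_norm ?invr_ge0 ?enorm_ge0// mulVf.
Qed.

End EuclideanTheory.

(** * Convex functions and gradients *)

Section Convexity.
Context {R : realType}.

Lemma convex_setP r (D : set 'cV[R]_r) :
  convex_set (M := 'cV[R]_r) D ->
  forall (t : R) x y, 0 <= t <= 1 -> D x -> D y -> D (t *: x + (1 - t) *: y).
Proof.
move=> cD t x y /andP[t0 t1] Dx Dy.
by have := cD x y (Itv01 t0 t1) (mem_set Dx) (mem_set Dy) => /set_mem.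
Qed.

Lemma convex_functionP r (D : set 'cV[R]_r) (f : 'cV[R]_r -> R) :
  convex_function (E := 'cV[R]_r) D f ->
  forall (t : R) x y, 0 <= t <= 1 -> D x -> D y ->
  f (t *: x + (1 - t) *: y) <= t * f x + (1 - t) * f y.
Proof.
move=> cf t x y /andP[t0 t1] Dx Dy.
exact: (cf (Itv01 t0 t1) x y (mem_set Dx) (mem_set Dy)).
Qed.

Lemma convex_functionI r (D : set 'cV[R]_r) (f : 'cV[R]_r -> R) :
  (forall (t : R) x y, 0 <= t <= 1 -> D x -> D y ->
    f (t *: x + (1 - t) *: y) <= t * f x + (1 - t) * f y) ->
  convex_function (E := 'cV[R]_r) D f.
Proof.
move=> cf t x y /set_mem Dx /set_mem Dy.
by apply: (cf t%:num x y) => //; rewrite ge0 le1.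
Qed.

Lemma convex_functionD r (D : set 'cV[R]_r) (f g : 'cV[R]_r -> R) :
  convex_function (E := 'cV[R]_r) D f -> convex_function (E := 'cV[R]_r) D g ->
  convex_function (E := 'cV[R]_r) D (fun x => f x + g x).
Proof.
move=> cf cg; apply: convex_functionI => t x y t01 Dx Dy.
by have := convex_functionP cf t01 Dx Dy; have := convex_functionP cg t01 Dx Dy; lra.
Qed.

Lemma convex_function_sum r (D : set 'cV[R]_r) (I : Type) (s : seq I) (p : pred I)
    (f : I -> 'cV[R]_r -> R) :
  (forall i, p i -> convex_function (E := 'cV[R]_r) D (f i)) ->
  convex_function (E := 'cV[R]_r) D (fun x => \sum_(i <- s | p i) f i x).
Proof.
move=> cf; apply: convex_functionI => t x y t01 Dx Dy.
rewrite !mulr_sumr -big_split; apply: ler_sum => i pi.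
by have := convex_functionP (cf i pi) t01 Dx Dy.
Qed.

Lemma convex_function_dot r s (D : set 'cV[R]_r) (m : 'cV[R]_s)
    (F : 'cV[R]_r -> 'cV[R]_s) :
  (forall a, 0 <= m a 0) -> convex_vfunction D F ->
  convex_function (E := 'cV[R]_r) D (fun x => dot m (F x)).
Proof.
move=> m0 cF; apply: convex_functionI => t x y t01 Dx Dy.
rewrite !dotE !mulr_sumr -big_split/=; apply: ler_sum => a _.
have /= := ler_wpM2l (m0 a) (convex_functionP (cF a) t01 Dx Dy); lra.
Qed.

(** Moving from the minimizer by a small step [t] towards [x] changes [psi + Q] by
    at most [t * (psi x - psi xp + c)], up to a term of order [t^2] that is
    negligible. No subgradient of [psi] is involved. *)
Lemma prox_optimality r (D : set 'cV[R]_r) (psi Q : 'cV[R]_r -> R) xp x c a :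
  convex_function (E := 'cV[R]_r) D psi -> D xp -> D x ->
  (forall t, 0 <= t <= 1 -> D (t *: x + (1 - t) *: xp)) ->
  (forall t, Q (xp + t *: (x - xp)) = Q xp + t * c + t ^+ 2 * a) ->
  (forall z, D z -> psi xp + Q xp <= psi z + Q z) -> psi xp <= psi x + c.
Proof.
move=> cpsi Dp Dx Dseg QE opt; rewrite leNgt; apply/negP => lt.
set delta := psi xp - (psi x + c); have d0 : 0 < delta by rewrite subr_gt0.
have da : 0 < delta + `|a| by rewrite ltr_wpDr.
(* This [t] satisfies [t * a < delta] whatever the sign of [a]. *)
pose t := delta / (delta + `|a|).
have tE : t * (delta + `|a|) = delta by rewrite divfK// gt_eqF.
have t0 : 0 < t by rewrite divr_gt0.
have t01 : 0 <= t <= 1 by rewrite ltW//= ler_pdivrMr// mul1r lerDl.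
have := opt _ (Dseg t t01); have := convex_functionP cpsi t01 Dx Dp.
have -> : Q (t *: x + (1 - t) *: xp) = Q xp + t * c + t ^+ 2 * a.
  by rewrite -QE scalerBr scalerBl scale1r addrCA.
move=> h1 h2; have : t * delta <= t * (t * a) by rewrite /delta; lra.
rewrite ler_pM2l// => h3; have := ler_norm a; move: t0 tE h3 d0; nra.
Qed.

Definition mean r (s : nat -> 'cV[R]_r) k : 'cV[R]_r :=
  k%:R^-1 *: \sum_(1 <= l < k.+1) s l.

Lemma meanS r (s : nat -> 'cV[R]_r) k : (0 < k)%N ->
  mean s k.+1 = (k%:R / k.+1%:R) *: mean s k
                + (1 - k%:R / k.+1%:R) *: s k.+1.
Proof.
move=> k0; rewrite /mean big_nat_recr//= scalerDr scalerA; congr (_ *: _ + _ *: _).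
  by rewrite mulrAC divff ?mul1r// pnatr_eq0 -lt0n.
by rewrite -natr1; field; rewrite natr1 pnatr_eq0.
Qed.

Lemma mean1 r (s : nat -> 'cV[R]_r) : mean s 1 = s 1%N.
Proof. by rewrite /mean big_nat1 invr1 scale1r. Qed.

Lemma frac_succ_itv k : 0 <= (k%:R / k.+1%:R : R) <= 1.
Proof.
by rewrite divr_ge0//= ler_pdivrMr ?ltr0n// mul1r ler_nat.
Qed.

Lemma convex_mean r (D : set 'cV[R]_r) (s : nat -> 'cV[R]_r) :
  convex_set (M := 'cV[R]_r) D -> (forall l, D (s l)) ->
  forall k, (0 < k)%N -> D (mean s k).
Proof.
move=> cD Ds; case=> // k _; elim: k => [|k IH]; first by rewrite mean1.
by rewrite meanS//; apply: convex_setP => //; exact: frac_succ_itv.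
Qed.

Lemma jensen_mean r (D : set 'cV[R]_r) (f : 'cV[R]_r -> R) (s : nat -> 'cV[R]_r) :
  convex_set (M := 'cV[R]_r) D -> convex_function (E := 'cV[R]_r) D f ->
  (forall l, D (s l)) ->
  forall k, (0 < k)%N -> k%:R * f (mean s k) <= \sum_(1 <= l < k.+1) f (s l).
Proof.
move=> cD cf Ds; case=> // k _; elim: k => [|k IH].
  by rewrite mean1 big_nat1 mul1r.
rewrite big_nat_recr//=; apply: le_trans (lerD IH (lexx _)).
rewrite meanS//; set a : R := k.+1%:R; set b : R := k.+2%:R.
have b0 : 0 < b by rewrite ltr0n.
have ab : b = a + 1 by rewrite /a /b natr1.
have := convex_functionP cf (frac_succ_itv k.+1)
  (convex_mean cD Ds (ltn0Sn k)) (Ds k.+2).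
move=> /(ler_wpM2l (ltW b0)) /le_trans; apply; rewrite le_eqVlt; apply/orP; left.
by apply/eqP; rewrite -/a -/b ab; field; rewrite gt_eqF//;
  have := ler0n R k; lra.
Qed.

Lemma dot_grad r (f : 'cV[R]_r -> R) x d :
  dot (grad f x) d = 'd (f : 'cV[R]_r -> R^o) x d.
Proof.
rewrite [in RHS](_ : d = \sum_a d a 0 *: delta_mx a 0); last first.
  by rewrite {1}(matrix_sum_delta d); apply: eq_bigr => a _; rewrite big_ord1.
rewrite linear_sum dotE; apply: eq_bigr => a _.
by rewrite linearZ mxE mulrC.
Qed.

Lemma is_derive_line r (f : 'cV[R]_r -> R) x d (s : R) :
  differentiable (f : 'cV[R]_r -> R^o) (x + s *: d) ->
  is_derive s 1 (fun t : R => f (x + t *: d) : R^o) (dot (grad f (x + s *: d)) d).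
Proof.
move=> df; have dd : derivable (f : _ -> R^o) (x + s *: d) d by exact: diff_derivable.
have E : (fun h : R => h^-1 *: (((fun t : R => f (x + t *: d) : R^o) \o shift s) (h *: 1)
             - f (x + s *: d)))
       = (fun h : R => h^-1 *: (((f : _ -> R^o) \o shift (x + s *: d)) (h *: d)
             - f (x + s *: d))).
  apply/funext => h /=; congr (_ *: (f _ - _)).
  by rewrite scaler1 scalerDl addrCA addrC -addrA.
split; first by rewrite /derivable E.
by rewrite dot_grad -deriveE// /derive E.
Qed.

Lemma grad_le r (D : set 'cV[R]_r) (f : 'cV[R]_r -> R) x y :
  convex_function (E := 'cV[R]_r) D f -> D x -> D y ->
  differentiable (f : 'cV[R]_r -> R^o) x ->
  f x + dot (grad f x) (y - x) <= f y.
Proof.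
move=> cf Dx Dy df.
have df0 : differentiable (f : 'cV[R]_r -> R^o) (x + 0 *: (y - x)).
  by rewrite scale0r addr0.
have [dl dv] := is_derive_line df0; rewrite scale0r addr0 in dv.
rewrite -lerBrDl -dv /derive cvg_at_rightE//; apply: limr_le.
  by apply: cvgP; apply: cvg_dnbhs_at_right; exact: dl.
near=> h => /=.
have h0 : 0 < h by near: h; exact: nbhs_right_gt.
have h1 : h <= 1 by near: h; exact: nbhs_right_le.
rewrite addr0 scaler1 scale0r addr0 ler_pdivrMl//.
have -> : x + h *: (y - x) = h *: y + (1 - h) *: x.
  by rewrite scalerBr scalerBl scale1r addrCA.
have h01 : 0 <= h <= 1 by rewrite ltW.
have := convex_functionP cf h01 Dy Dx; lra.
Unshelve. all: by end_near. Qed.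

Lemma is_derive_sub_quadratic (phi : R -> R) (s dphi c e : R) :
  is_derive s 1 phi dphi ->
  is_derive s 1 (fun t : R => phi t - t * c - e * t ^+ 2) (dphi - c - 2 * e * s).
Proof.
move=> ds.
have -> : (fun t : R => phi t - t * c - e * t ^+ 2)
        = phi - c *: (id : R -> R) - e *: ((id : R -> R) ^+ 2).
  by apply/funext => t; rewrite !fctE /= [t * c]mulrC.
apply: is_derive_eq; rewrite /GRing.scale/=; ring.
Qed.

(** Along a segment the map is its tangent plus at most [K s^2 |d|^2 / 2]: the
    difference has a nonpositive derivative in the parameter [s]. *)
Lemma descent r (D : set 'cV[R]_r) (f : 'cV[R]_r -> R) K x y :
  convex_set (M := 'cV[R]_r) D ->
  (forall z, D z -> differentiable (f : 'cV[R]_r -> R^o) z) ->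
  lip_on D K (grad f) -> D x -> D y ->
  f y <= f x + dot (grad f x) (y - x) + K / 2 * enorm (y - x) ^+ 2.
Proof.
move=> cD df lf Dx Dy; set d := y - x; set g := grad f x.
have Dl s : 0 <= s <= 1 -> D (x + s *: d).
  move=> s01; have -> : x + s *: d = s *: y + (1 - s) *: x.
    by rewrite scalerBr scalerBl scale1r addrCA.
  exact: convex_setP.
pose psi (s : R) : R^o := f (x + s *: d) - s * dot g d - K / 2 * enorm d ^+ 2 * s ^+ 2.
have dpsi (s : R) : 0 <= s <= 1 ->
    is_derive s 1 psi (dot (grad f (x + s *: d)) d - dot g d - K * enorm d ^+ 2 * s).
  move=> s01; have ds := is_derive_line (df _ (Dl s s01)).
  have -> : K * enorm d ^+ 2 * s = 2 * (K / 2 * enorm d ^+ 2) * s by field.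
  exact: is_derive_sub_quadratic.
have K0 (s : R) : 0 <= s <= 1 ->
    dot (grad f (x + s *: d)) d - dot g d <= K * enorm d ^+ 2 * s.
  move=> s01; have /andP[s0 _] := s01; rewrite -dotBl.
  apply: le_trans (dot_le _ _) _.
  have := lf (x + s *: d) x (Dl s s01) Dx.
  have -> : x + s *: d - x = s *: d by rewrite addrAC subrr add0r.
  rewrite enormZ (ger0_norm s0) => le1.
  have := ler_wpM2r (enorm_ge0 d) le1.
  move=> /le_trans; apply; rewrite le_eqVlt; apply/orP; left; apply/eqP; ring.
have oo (s : R) : s \in `]0, 1[%R -> 0 <= s <= 1.
  by rewrite in_itv/= => /andP[/ltW-> /ltW->].
have : psi 1 <= psi 0.
  apply: (@ler0_derive1_nincr _ psi 0 1) => //.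
  - by move=> s /oo /dpsi [].
  - move=> s /oo s01; rewrite derive1E; have [_ ->] := dpsi s s01.
    by rewrite subr_le0; exact: K0.
  - apply: derivable_within_continuous => s; rewrite in_itv/= => s01.
    by have [] := dpsi s s01.
rewrite /psi scale0r scale1r addr0 addrCA subrr addr0 expr0n/= expr1n.
lra.
Qed.

End Convexity.

(** * Stacked vectors *)

Section Stacks.
Context {R : realType} {n : nat}.

Lemma dot_mxcol (p_ : 'I_n -> nat) (u v : forall i, 'cV[R]_(p_ i)) :
  dot (\mxcol_i u i) (\mxcol_i v i) = \sum_i dot (u i) (v i).
Proof. by rewrite /dot tr_mxcol mul_mxrow_mxcol summxE. Qed.

Lemma dot_col_mx r s (a c : 'cV[R]_r) (b d : 'cV[R]_s) :
  dot (col_mx a b) (col_mx c d) = dot a c + dot b d.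
Proof. by rewrite /dot tr_col_mx mul_row_col mxE. Qed.

Lemma enorm_submxcol_le (p_ : 'I_n -> nat) (u : forall i, 'cV[R]_(p_ i)) i :
  enorm (u i) <= enorm (\mxcol_i u i).
Proof.
apply: enorm_le_sqr; first exact: enorm_ge0.
rewrite sqr_enorm dot_mxcol (bigD1 i)//= lerDl sumr_ge0// => j _.
exact: dotvv_ge0.
Qed.

Lemma enorm_usubmx_le r s (v : 'cV[R]_(r + s)) : enorm (usubmx v) <= enorm v.
Proof.
apply: enorm_le_sqr; first exact: enorm_ge0.
by rewrite sqr_enorm -{3 4}[v]vsubmxK dot_col_mx lerDl dotvv_ge0.
Qed.

Lemma enorm_dsubmx_le r s (v : 'cV[R]_(r + s)) : enorm (dsubmx v) <= enorm v.
Proof.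
apply: enorm_le_sqr; first exact: enorm_ge0.
by rewrite sqr_enorm -{3 4}[v]vsubmxK dot_col_mx lerDr dotvv_ge0.
Qed.

Lemma mxcol_ge_entry (p_ : 'I_n -> nat) (u : forall i, 'cV[R]_(p_ i)) b i a :
  (forall c, (\mxcol_i u i) c 0 <= b) -> u i a 0 <= b.
Proof.
move=> ub; rewrite -(mxcolK u i) mxE; exact: ub.
Qed.

End Stacks.

Section ProblemStacks.
Context {R : realType} {n : nat} (P : problem R n).
Implicit Types (x : forall i, 'cV[R]_(dx P i)) (t : 'I_n -> 'cV[R]_(pt P)).

Lemma yblock_stack x t i : yblock (stack x t) i = col_mx (x i) (t i).
Proof. by rewrite /yblock /stack mxcolK. Qed.

Lemma xpart_stack x t i : xpart (stack x t) i = x i.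
Proof. by rewrite /xpart yblock_stack col_mxKu. Qed.

Lemma tpart_stack x t i : tpart (stack x t) i = t i.
Proof. by rewrite /tpart yblock_stack col_mxKd. Qed.

Lemma stackK (y : 'cV[R]_(ydim P)) : stack (xpart y) (tpart y) = y.
Proof.
rewrite /stack -[RHS]submxcolK; apply: eq_mxcol => i.
by rewrite /xpart /tpart vsubmxK.
Qed.

Lemma stackB x t x' t' :
  stack x t - stack x' t' = stack (fun i => x i - x' i) (fun i => t i - t' i).
Proof.
rewrite /stack -mxcolB; apply: eq_mxcol => i.
by rewrite opp_col_mx add_col_mx.
Qed.

Lemma stack0 : stack (fun i => 0 : 'cV[R]_(dx P i)) (fun=> 0) = 0.
Proof.
by rewrite /stack -[RHS]mxcol0; apply: eq_mxcol => i; rewrite col_mx0.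
Qed.

Lemma dot_stack x t x' t' :
  dot (stack x t) (stack x' t')
  = \sum_i dot (x i) (x' i) + \sum_i dot (t i) (t' i).
Proof.
by rewrite /stack dot_mxcol -big_split; apply: eq_bigr => i _; rewrite dot_col_mx.
Qed.

Lemma G_stack x t : G (stack x t) = \mxcol_i Gi x t i.
Proof.
rewrite /G; apply: eq_mxcol => i; rewrite /Gi xpart_stack tpart_stack.
by congr col_mx; apply: eq_bigr => j _; rewrite xpart_stack.
Qed.

Lemma B_stack x t :
  B P *m stack x t - c P = \mxcol_i (Bi P i *m col_mx (x i) (t i) - ci P i).
Proof.
rewrite /B /stack /c mul_mxblock_mxrow -mxcolB; apply: eq_mxcol => i.
rewrite (bigD1 i)//= eqxx big1 ?addr0// => j /negPf ji.
by rewrite eq_sym ji mul0mx.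
Qed.

Lemma Bs_mul x t : Bs P *m stack x t = \mxcol_i sparse_eq x i.
Proof.
rewrite /Bs /stack mul_mxblock_mxrow; apply: eq_mxcol => i.
rewrite /sparse_eq [RHS]big_mkcond/=; apply: eq_bigr => j _.
case: ifP => _; last by rewrite mul0mx.
by rewrite mul_row_col mul0mx addr0.
Qed.

Lemma Bs_stack x t : Bs P *m stack x t - cs P = \mxcol_i (sparse_eq x i - bs P i).
Proof. by rewrite Bs_mul /cs -mxcolB. Qed.

Lemma ones_mul (u : 'I_n -> 'cV[R]_(mt P + pt P)) :
  (ones_kronI P)^T *m (\mxcol_i u i) = \sum_i u i.
Proof.
rewrite /ones_kronI tr_mxcol mul_mxrow_mxcol; apply: eq_bigr => i _.
by rewrite tr_scalar_mx mul1mx.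
Qed.

Lemma ones_mulr (b : 'cV[R]_(mt P + pt P)) :
  ones_kronI P *m b = (\mxcol_(i < n) b : 'cV[R]_(udim P)).
Proof. by rewrite /ones_kronI mxcol_mul; apply: eq_mxcol => i; rewrite mul1mx. Qed.

Lemma kronI_mul (K : 'M[R]_n) (u : 'I_n -> 'cV[R]_(mt P + pt P)) :
  kronI P K *m (\mxcol_i u i) = \mxcol_i \sum_j K i j *: u j.
Proof.
rewrite /kronI mul_mxblock_mxrow; apply: eq_mxcol => i.
by apply: eq_bigr => j _; rewrite mul_scalar_mx.
Qed.

Lemma kronI_tr (K : 'M[R]_n) : (kronI P K)^T = kronI P K^T.
Proof.
rewrite /kronI tr_mxblock; apply/eq_mxblockP => i j.
by rewrite tr_scalar_mx mxE.
Qed.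

Lemma kronID (K K' : 'M[R]_n) : kronI P (K + K') = kronI P K + kronI P K'.
Proof.
rewrite /kronI -mxblockD; apply/eq_mxblockP => i j.
by rewrite mxE raddfD.
Qed.

(** Transfers positivity from [K] to [kronI P K], one coordinate at a time. *)
Lemma kronI_form (K : 'M[R]_n) (u : 'I_n -> 'cV[R]_(mt P + pt P)) :
  dot (\mxcol_i u i) (kronI P K *m \mxcol_i u i)
  = \sum_a dot (\col_i u i a 0) (K *m \col_i u i a 0).
Proof.
rewrite kronI_mul dot_mxcol.
under eq_bigr do rewrite dotE.
rewrite exchange_big; apply: eq_bigr => a _; rewrite dotE.
apply: eq_bigr => i _; rewrite !mxE summxE; congr (_ * _).
by apply: eq_bigr => j _; rewrite !mxE.
Qed.

Lemma psd_kronI K : psd K -> psd (kronI P K).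
Proof.
move=> [Kt K0]; split=> [|u]; first by rewrite kronI_tr Kt.
rewrite wformE -[u]submxcolK kronI_form sumr_ge0// => a _.
by rewrite -wformE.
Qed.

Lemma psd_1_sub_kronI K : psd (1%:M - K) -> psd (1%:M - kronI P K).
Proof.
move=> [Kt K0]; have Kt' : K^T = K.
  by apply: (@addrI _ 1%:M); apply: oppr_inj; move: Kt;
     rewrite linearB/= tr_scalar_mx => /addrI/oppr_inj ->.
split=> [|u]; first by rewrite linearB/= tr_scalar_mx kronI_tr Kt'.
rewrite wformE mulmxBl mul1mx dotBr -[u]submxcolK kronI_form dot_mxcol.
under eq_bigr do rewrite dotE.
rewrite exchange_big/= -sumrB sumr_ge0// => a _.
have := K0 (\col_i submxcol u i a 0); rewrite wformE mulmxBl mul1mx dotBr.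
rewrite [X in 0 <= X - _](_ : _ = \sum_i submxcol u i a 0 * submxcol u i a 0)//.
by rewrite dotE; apply: eq_bigr => i _; rewrite !mxE.
Qed.

Lemma kronI_ones (K : 'M[R]_n) (k : R) :
  K *m const_mx 1 = k *: const_mx 1 :> 'cV[R]_n ->
  kronI P K *m ones_kronI P = k *: ones_kronI P.
Proof.
move=> K1; rewrite /kronI /ones_kronI mul_mxblock_mxrow.
rewrite [RHS](_ : _ = \mxcol_(i < n) (k *: 1%:M)); last first.
  by apply/matrixP => a b; rewrite !mxE.
apply: eq_mxcol => i; under eq_bigr do rewrite mulmx1.
rewrite -raddf_sum/=; have := congr1 (fun v : 'cV[R]_n => v i 0) K1.
rewrite !mxE mulr1 => <-; rewrite scale_scalar_mx mulr1; congr (_%:M).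
by apply: eq_bigr => j _; rewrite mxE mulr1.
Qed.

Lemma ones_ones : (ones_kronI P)^T *m ones_kronI P = n%:R%:M.
Proof.
rewrite /ones_kronI tr_mxcol mul_mxrow_mxcol.
under eq_bigr do rewrite tr_scalar_mx mul1mx.
by rewrite sumr_const card_ord -raddfMn.
Qed.

(** The residual [v - H H^+ v] lies in the null space of [H], hence is constant
    over the nodes, and it is orthogonal to such vectors when [v] is. *)
Lemma kronI_range (K : 'M[R]_n) (v : 'cV[R]_(udim P)) : (0 < n)%N -> psd K ->
  (forall x : 'cV[R]_n, K *m x = 0 <-> exists a : R, x = a *: const_mx 1) ->
  (ones_kronI P)^T *m v = 0 -> exists zeta, kronI P K *m zeta = v.
Proof.
move=> n0 psdK nullK v0; set H := kronI P K.
have [Ht _] : psd H := psd_kronI psdK.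
have K1 : K *m const_mx 1 = 0 *: const_mx 1 :> 'cV[R]_n.
  by rewrite scale0r; apply/nullK; exists 1; rewrite scale1r.
have HJ : H *m ones_kronI P = 0 by rewrite (kronI_ones K1) scale0r.
have [HXH _ HXt _] := mpinvP H; set X := mpinv H in HXH HXt *.
have HHX : H *m (H *m X) = H.
  by rewrite -HXt trmx_mul Ht mulmxA -{1 2}Ht -!trmx_mul mulmxA HXH.
exists (X *m v); apply/eqP; rewrite eq_sym -subr_eq0; apply/eqP.
set r := v - _; pose i0 := Ordinal n0.
have Hr : H *m r = 0 by rewrite mulmxBr !mulmxA -(mulmxA H) HHX subrr.
have rE : r = ones_kronI P *m submxcol r i0.
  rewrite ones_mulr -[LHS]submxcolK; apply: eq_mxcol => i.
  apply/colP => a.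
  have /nullK [b rb] : K *m (\col_j submxcol r j a 0) = 0.
    move: Hr; rewrite -{1}[r]submxcolK kronI_mul => Hr.
    apply/colP => j; rewrite [RHS]mxE.
    have := congr1 (fun w => submxcol w j a 0) Hr.
    rewrite mxcolK submxcol0 [X in _ = X -> _]mxE => <-; rewrite mxE summxE.
    by apply: eq_bigr => l _; rewrite mxE [RHS]mxE.
  have rj j : submxcol r j a 0 = b.
    have := congr1 (fun w : 'cV[R]_n => w j 0) rb.
    by rewrite mxE => ->; rewrite !mxE mulr1.
  by rewrite !rj.
apply: dotvv_eq0; rewrite {2}/r dotBr {1}rE dot_mull v0 dot0r sub0r.
by rewrite mulmxA -mulmxA dot_mulr Ht Hr dot0l oppr0.
Qed.

End ProblemStacks.

(** * One-step drift of the energy terms *)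

Section OneStep.
Context {R : realType}.

Lemma inertia_step N (y0 y1 ys : 'cV[R]_N) :
  dot (y1 - y0) (ys - y1)
  = (dot (y0 - ys) (y0 - ys) - dot (y1 - ys) (y1 - ys)
     - dot (y1 - y0) (y1 - y0)) / 2.
Proof.
by rewrite !dotlin (dotC ys y0) (dotC ys y1) (dotC y1 y0); field.
Qed.

Lemma multiplier_step V gamma (w e0 e1 : 'cV[R]_V) : 0 < gamma ->
  - dot (w + gamma *: e0) e1
  = (dot w w - dot (w + gamma *: e1) (w + gamma *: e1)) / (2 * gamma)
    - gamma / 2 * dot e0 e0 + gamma / 2 * dot (e1 - e0) (e1 - e0).
Proof.
move=> gamma0; rewrite !dotlin (dotC e1 e0) (dotC e1 w); field.
by rewrite gt_eqF.
Qed.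

(** Entrywise this is the inequality
    [max(- b, a + b)^2 <= a^2 + 2 a b + 2 b^2]. *)
Lemma queue_step Q (q s0 s1 q1 : 'cV[R]_Q) :
  q1 = vmax (- s1) (q + s1) ->
  - dot (q + s0) s1
  <= (dot q q - dot s0 s0) / 2 - (dot q1 q1 - dot s1 s1) / 2
     + dot (s1 - s0) (s1 - s0) / 2.
Proof.
move=> q1E; have : dot q1 q1 <= dot q q + 2 * dot q s1 + 2 * dot s1 s1.
  rewrite !dotE !mulr_sumr -!big_split/= ler_sum// => a _; rewrite q1E !mxE.
  move: (q a 0) (s1 a 0) => x b; rewrite maxEle; case: ifP => _; first nra.
  have := sqr_ge0 (x + b); nra.
rewrite !dotlin (dotC s1 s0); lra.
Qed.

Lemma consensus_step U rho (W H : 'M[R]_U) (u0 u1 zeta zeta1 : 'cV[R]_U) :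
  psd W -> psd H -> psd (1%:M - (W + H)) -> 0 < rho ->
  zeta1 = zeta + rho *: u1 ->
  dot u1 (rho *: (W *m u0) - rho *: u1 - H *m zeta)
  <= (dot zeta (H *m zeta) - dot zeta1 (H *m zeta1)) / (2 * rho)
     + rho / 2 * (dot u0 (W *m u0) - dot u1 (W *m u1)).
Proof.
move=> pW pH pWH rho0 zeta1E.
have HW := psd_form_ge0 u1 pWH; have dW := psd_form_ge0 (u1 - u0) pW.
have H0 := psd_form_ge0 u1 pH.
have -> : (dot zeta (H *m zeta) - dot zeta1 (H *m zeta1)) / (2 * rho)
        = - dot u1 (H *m zeta) - rho / 2 * dot u1 (H *m u1).
  rewrite zeta1E mulmxDr -scalemxAr !dotlin (psd_formC zeta u1 pH); field.
  by rewrite gt_eqF.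
move: HW dW; rewrite mulmxBl mulmxBr mul1mx mulmxDl !dotlin (psd_formC u0 u1 pW).
move=> HW dW.
have := mulr_ge0 (ltW rho0) HW; have := mulr_ge0 (ltW rho0) dW.
have := mulr_ge0 (ltW rho0) H0; lra.
Qed.

End OneStep.

(** * The energy argument *)

Lemma ge_sqr_bound (R : realType) (a c C x : R) :
  0 < c -> c * (x - a) ^+ 2 <= C -> x <= a + Num.sqrt (C / c).
Proof.
move=> c0; rewrite mulrC -ler_pdivlMr// => xa.
rewrite -lerBlDl; apply: le_trans (ler_norm _) _.
by rewrite -sqrtr_sqr ler_wsqrtr.
Qed.

Section Drift.
Context {R : realType} {N U Q V r n : nat}.
Context (gamma lambda rho alpha Lf L : R).
Context (gamma_gt0 : 0 < gamma) (rho_gt0 : 0 < rho) (alpha_ge0 : 0 <= alpha).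
Context (Lf_ge0 : 0 <= Lf) (alpha_ge : Lf + L ^+ 2 <= alpha).
Context (W H : 'M[R]_U) (J : 'M[R]_(U, r)).
Context (psdW : psd W) (psdH : psd H) (psdWH : psd (1%:M - (W + H))).
Context (WJ : W *m J = J) (HJ : H *m J = 0) (JJ : J^T *m J = n%:R%:M).
Context (y : nat -> 'cV[R]_N) (u zeta : nat -> 'cV[R]_U) (q s : nat -> 'cV[R]_Q).
Context (e w : nat -> 'cV[R]_V) (phi : nat -> R).
Context (ys : 'cV[R]_N) (ss : 'cV[R]_Q) (phis : R).
Context (w0 : w 0%N = 0) (wS : forall k, w k.+1 = w k + gamma *: e k.+1).
Context (q0 : q 0%N = vmax (- s 0%N) 0).
Context (qS : forall k, q k.+1 = vmax (- s k.+1) (q k + s k.+1)).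
Context (zetaS : forall k, zeta k.+1 = zeta k + rho *: u k.+1).
Context (ss_le0 : vle ss 0).
Context (e_lip : forall k, dot (e k.+1 - e k) (e k.+1 - e k)
                  <= lambda ^+ 2 * dot (y k.+1 - y k) (y k.+1 - y k)).
Context (s_lip : forall k, dot (s k.+1 - s k) (s k.+1 - s k)
                  <= L ^+ 2 * dot (y k.+1 - y k) (y k.+1 - y k)).
Context (s_lips : forall k, dot (s k - ss) (s k - ss)
                  <= L ^+ 2 * dot (y k - ys) (y k - ys)).

(** [H *m zeta k] is the deviation of [z] from its optimal value, so the first
    term is the square of the seminorm of that deviation weighted by the
    pseudoinverse of [H]. *)
Definition energy k :=
  dot (zeta k) (H *m zeta k) / (2 * rho)
  + rho / 2 * dot (u k) (W *m u k) + dot (w k) (w k) / (2 * gamma)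
  + (gamma * lambda ^+ 2 + alpha) / 2 * dot (y k - ys) (y k - ys)
  + (dot (q k) (q k) - dot (s k) (s k)) / 2.

(** By the update of [u], this is the deviation of [B y - c] at step [k.+1] from
    its value at the optimum. *)
Definition consensus_gap k :=
  rho *: u k.+1 - rho *: (W *m u k) + H *m zeta k.

Context (step_ineq : forall k,
  phi k.+1 + dot (q k + s k) (s k.+1)
  <= phis + dot (q k + s k) ss - dot (w k + gamma *: e k) (e k.+1)
     + (gamma * lambda ^+ 2 + alpha) * dot (y k.+1 - y k) (ys - y k.+1)
     - dot (u k.+1) (consensus_gap k)
     + Lf / 2 * dot (y k.+1 - y k) (y k.+1 - y k)).

Lemma queue_ge0 k a : 0 <= q k a 0.
Proof.
elim: k => [|k IH]; first by rewrite q0 !mxE le_max lexx orbT.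
rewrite qS !mxE le_max; move: (s k.+1 a 0) => x.
by have [x0|x0] := leP x 0; [rewrite oppr_ge0 x0|rewrite addr_ge0 ?orbT// ltW].
Qed.

Lemma queue_weight_ge0 k a : 0 <= q k a 0 + s k a 0.
Proof.
by case: k => [|k]; [rewrite q0|rewrite qS]; rewrite !mxE -lerBlDr sub0r le_max lexx.
Qed.

(** It fails at time 0, where the queue is the negative part of [s 0] only. *)
Lemma queue_ge_norm k a : `|s k.+1 a 0| <= q k.+1 a 0.
Proof.
rewrite qS !mxE ler_norml le_max lerDr queue_ge0 orbT andbT.
by rewrite lerNl le_max lexx.
Qed.

(** The positive remainders of the one-step relations are bounded by multiples
    of [|y k.+1 - y k|^2], and the inertia term subtracts such a multiple; the
    total is nonpositive because [Lf + L ^+ 2 <= alpha]. *)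
Lemma energy_step k : phi k.+1 - phis <= energy k - energy k.+1.
Proof.
have ss0 : dot (q k + s k) ss <= 0.
  rewrite dotE -oppr_ge0 -sumrN sumr_ge0// => a _.
  rewrite -mulrN mulr_ge0// ?mxE ?queue_weight_ge0//.
  by rewrite oppr_ge0; have := ss_le0 a; rewrite mxE.
have hq := queue_step (s k) (qS k).
have hw := multiplier_step (w k) (e k) (e k.+1) gamma_gt0; rewrite -wS in hw.
have hu := consensus_step (u k) psdW psdH psdWH rho_gt0 (zetaS k).
have gapN : dot (u k.+1) (rho *: (W *m u k) - rho *: u k.+1 - H *m zeta k)
          = - dot (u k.+1) (consensus_gap k).
  by rewrite /consensus_gap !dotlin; ring.
have g2 : 0 <= gamma / 2 by rewrite divr_ge0 ?ltW.
have he : gamma / 2 * dot (e k.+1 - e k) (e k.+1 - e k)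
       <= gamma / 2 * (lambda ^+ 2 * dot (y k.+1 - y k) (y k.+1 - y k)).
  exact: ler_wpM2l.
have ha : 0 <= (alpha - (Lf + L ^+ 2)) * dot (y k.+1 - y k) (y k.+1 - y k).
  by rewrite mulr_ge0 ?dotvv_ge0// subr_ge0.
have hee : 0 <= gamma / 2 * dot (e k) (e k).
  by rewrite mulr_ge0 ?dotvv_ge0.
have := step_ineq k; rewrite inertia_step; have := s_lip k.
rewrite gapN in hu; rewrite /energy.
lra.
Qed.

(** The term [- |s|^2 / 2] is absorbed by the distance to [ys] and by half of
    the queue: entrywise [s ss - ss^2 <= s^2 / 4 <= q^2 / 4]. *)
Lemma energy_ge k :
  dot (u k.+1) (W *m u k.+1) * (rho / 2) + dot (w k.+1) (w k.+1) / (2 * gamma)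
  + dot (q k.+1) (q k.+1) / 4 - dot ss ss / 2 <= energy k.+1.
Proof.
have hs : dot (s k.+1) ss - dot ss ss <= dot (q k.+1) (q k.+1) / 4.
  rewrite !dotE mulr_suml -sumrB; apply: ler_sum => a _.
  have := queue_ge_norm k a; have := queue_ge0 k.+1 a.
  move: (q k.+1 a 0) (s k.+1 a 0) (ss a 0) => x b c x0 bx.
  have : b ^+ 2 <= x ^+ 2.
    by rewrite -(@real_normK _ b) ?num_real// ler_sqr ?nnegrE.
  have := sqr_ge0 (b / 2 - c); nra.
have hz : 0 <= dot (zeta k.+1) (H *m zeta k.+1) / (2 * rho).
  by rewrite divr_ge0 ?psd_form_ge0// mulr_ge0// ltW.
have hy : 0 <= (gamma * lambda ^+ 2 + (alpha - L ^+ 2))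
               * dot (y k.+1 - ys) (y k.+1 - ys).
  have gl : 0 <= gamma * lambda ^+ 2 := mulr_ge0 (ltW gamma_gt0) (sqr_ge0 _).
  by rewrite mulr_ge0 ?dotvv_ge0//; move: alpha_ge Lf_ge0 gl; lra.
have := s_lips k.+1; rewrite /energy !dotlin (dotC ss (s k.+1)).
move: hs hz hy; rewrite !dotlin; lra.
Qed.

Lemma energyS_ge0 k : 0 <= energy k.+1.
Proof.
have hq : dot (s k.+1) (s k.+1) <= dot (q k.+1) (q k.+1).
  rewrite !dotE; apply: ler_sum => a _; rewrite -!expr2.
  rewrite -(@real_normK _ (s k.+1 a 0)) ?num_real// ler_sqr ?nnegrE//.
    exact: queue_ge_norm.
  exact: queue_ge0.
rewrite /energy !addr_ge0// ?divr_ge0 ?subr_ge0 ?dotvv_ge0 ?psd_form_ge0//.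
- by rewrite mulr_ge0 ?ltW.
- by rewrite mulr_ge0 ?psd_form_ge0// divr_ge0 ?ltW.
- by rewrite mulr_ge0 ?ltW.
- have gl : 0 <= gamma * lambda ^+ 2 := mulr_ge0 (ltW gamma_gt0) (sqr_ge0 _).
  by rewrite mulr_ge0 ?dotvv_ge0// divr_ge0// addr_ge0.
Qed.

(** At time 0 the queue only dominates the negative part of [s 0]; the
    remaining positive part is at most [s 0 - ss] since [ss <= 0]. *)
Lemma energy0_ge0 : 0 <= energy 0.
Proof.
have hq : dot (s 0%N) (s 0%N) - dot (s 0%N - ss) (s 0%N - ss) <= dot (q 0%N) (q 0%N).
  rewrite q0 !dotE -sumrB; apply: ler_sum => a _; have := ss_le0 a.
  rewrite !mxE; move: (s 0%N a 0) (ss a 0) => b c c0; rewrite maxEle.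
  case: ifP => [|_]; last by have := sqr_ge0 (b - c); nra.
  rewrite oppr_le0 => b0; have := mulr_ge0 b0 (_ : 0 <= - c).
  by rewrite oppr_ge0 => /(_ c0); have := sqr_ge0 c; nra.
have hz : 0 <= dot (zeta 0%N) (H *m zeta 0%N) / (2 * rho).
  by rewrite divr_ge0 ?psd_form_ge0// mulr_ge0// ltW.
have hu : 0 <= rho / 2 * dot (u 0%N) (W *m u 0%N).
  by rewrite mulr_ge0 ?psd_form_ge0// divr_ge0 ?ltW.
have hy : 0 <= (gamma * lambda ^+ 2 + (alpha - L ^+ 2))
               * dot (y 0%N - ys) (y 0%N - ys).
  have gl : 0 <= gamma * lambda ^+ 2 := mulr_ge0 (ltW gamma_gt0) (sqr_ge0 _).
  by rewrite mulr_ge0 ?dotvv_ge0//; move: alpha_ge Lf_ge0 gl; lra.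
have := s_lips 0; rewrite /energy w0 dot0l; move: hq hz hu hy; lra.
Qed.

Lemma energy_telescope k :
  \sum_(1 <= l < k.+1) (phi l - phis) <= energy 0 - energy k.
Proof.
elim: k => [|k IH]; first by rewrite big_geq// subrr.
by rewrite big_nat_recr//=; have := energy_step k; lra.
Qed.

Lemma sum_s_le_queue k a : (\sum_(1 <= l < k.+1) s l) a 0 <= q k a 0.
Proof.
elim: k => [|k IH]; first by rewrite big_geq// mxE queue_ge0.
by rewrite big_nat_recr//= qS !mxE le_max lerD2r IH orbT.
Qed.

Lemma sum_e k : gamma *: (\sum_(1 <= l < k.+1) e l) = w k.
Proof.
elim: k => [|k IH]; first by rewrite big_geq// scaler0 w0.
by rewrite big_nat_recr//= scalerDr IH wS.
Qed.

(** [J^T] sums over the nodes, which annihilates [H] and is left unchanged by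
    [W], so the summed gap is a difference of consecutive iterates. *)
Lemma sum_gap k :
  \sum_(0 <= l < k) (J^T *m consensus_gap l) = rho *: (J^T *m u k - J^T *m u 0).
Proof.
have JW : J^T *m W = J^T by case: psdW => Wt _; rewrite -[in LHS]Wt -trmx_mul WJ.
have JH : J^T *m H = 0 by case: psdH => Ht _; rewrite -[in LHS]Ht -trmx_mul HJ trmx0.
elim: k => [|k IH]; first by rewrite big_geq// subrr scaler0.
rewrite big_nat_recr//= IH /consensus_gap mulmxDr mulmxBr !mulmxA JH mul0mx addr0.
by rewrite -!scalemxAr mulmxA JW -scalerBr -scalerDr addrC addrA subrK.
Qed.

Lemma wnorm_J b : wnorm W (J *m b) = Num.sqrt n%:R * enorm b.
Proof.
rewrite /wnorm wformE mulmxA WJ dot_mull mulmxA JJ mul_scalar_mx dotZr.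
by rewrite sqrtrM ?ler0n.
Qed.

Lemma dot_avg_le b v : dot b (J^T *m v) <= Num.sqrt n%:R * enorm b * wnorm W v.
Proof.
rewrite -wnorm_J; apply: le_trans (psd_form_le _ _ psdW).
by rewrite -dot_mull -{1}WJ -mulmxA dot_mull (proj1 psdW).
Qed.

(** Take [b] in [dot_avg_le] to be [J^T *m v] itself. *)
Lemma enorm_avg_le v : enorm (J^T *m v) <= Num.sqrt n%:R * wnorm W v.
Proof.
have := dot_avg_le (J^T *m v) v; rewrite -sqr_enorm mulrAC expr2.
have [->|v0] := eqVneq (enorm (J^T *m v)) 0.
  by rewrite mulr_ge0 ?sqrtr_ge0 ?wnorm_ge0.
by rewrite ler_pM2r// lt_def v0 enorm_ge0.
Qed.

Context (qs : 'cV[R]_Q) (us : 'cV[R]_r) (vs : 'cV[R]_V) (qs_ge0 : vle 0 qs).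
Context (saddle : forall k,
  phis <= phi k.+1 + dot qs (s k.+1) + dot us (J^T *m consensus_gap k)
          + dot vs (e k.+1)).

Definition energy_bound :=
  energy 0 + rho * Num.sqrt n%:R * enorm us * wnorm W (u 0)
  + rho * n%:R / 2 * enorm us ^+ 2 + (2 * gamma)^-1 * enorm vs ^+ 2
  + enorm qs ^+ 2 + 2^-1 * enorm ss ^+ 2.

Lemma sum_phi_ge k :
  - dot qs (\sum_(1 <= l < k.+1) s l)
  - dot us (\sum_(0 <= l < k) (J^T *m consensus_gap l))
  - dot vs (\sum_(1 <= l < k.+1) e l) <= \sum_(1 <= l < k.+1) (phi l - phis).
Proof.
elim: k => [|k IH].
  by rewrite !big_geq// !dot0r oppr0 !addr0.
rewrite ![\sum_(_ <= _ < k.+2) _]big_nat_recr//=.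
rewrite [\sum_(0 <= _ < _) _]big_nat_recr//= !dotDr.
by have := saddle k; lra.
Qed.

(** The dual variables enter the energy quadratically but the multiplier
    inequality only linearly: completing the squares bounds them. *)
Lemma dual_squares_le k :
  (enorm (q k.+1) / 2 - enorm qs) ^+ 2
  + rho / 2 * (wnorm W (u k.+1) - Num.sqrt n%:R * enorm us) ^+ 2
  + (2 * gamma)^-1 * (enorm (w k.+1) - enorm vs) ^+ 2 <= energy_bound.
Proof.
have hq : dot qs (\sum_(1 <= l < k.+2) s l) <= enorm qs * enorm (q k.+1).
  apply: le_trans (dot_le _ _); rewrite !dotE; apply: ler_sum => a _.
  by rewrite ler_wpM2l ?sum_s_le_queue//; have := qs_ge0 a; rewrite mxE.
have hu : dot us (\sum_(0 <= l < k.+1) (J^T *m consensus_gap l))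
  <= rho * (Num.sqrt n%:R * enorm us * (wnorm W (u k.+1) + wnorm W (u 0))).
  rewrite sum_gap dotZr ler_wpM2l ?(ltW rho_gt0)// dotBr mulrDr lerD ?dot_avg_le//.
  rewrite -dotNr -mulmxN; apply: le_trans (dot_avg_le _ _) _.
  by rewrite /wnorm !wformE mulmxN dotNl dotNr opprK.
have hv : dot vs (\sum_(1 <= l < k.+2) e l) <= gamma^-1 * (enorm vs * enorm (w k.+1)).
  by rewrite -sum_e ler_pdivlMl// -dotZr dot_le.
have := sum_phi_ge k.+1; have := energy_telescope k.+1; have := energy_ge k.
rewrite -sqr_wnorm ?psd_form_ge0// -!sqr_enorm /energy_bound.
have nn : Num.sqrt n%:R ^+ 2 = n%:R :> R by rewrite sqr_sqrtr.
have gg : (2 * gamma)^-1 = gamma^-1 / 2 by rewrite invfM mulrC.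
rewrite gg sqrrB exprMn [in X in _ -> _ -> _ -> X]sqrrB exprMn nn.
move: hq hu hv; lra.
Qed.

Lemma queue_bound k :
  enorm (q k.+1) <= 2 * (enorm qs + Num.sqrt energy_bound).
Proof.
have : 4^-1 * (enorm (q k.+1) - 2 * enorm qs) ^+ 2 <= energy_bound.
  apply: le_trans (dual_squares_le k).
  have : 0 <= rho / 2 * (wnorm W (u k.+1) - Num.sqrt n%:R * enorm us) ^+ 2.
    by rewrite mulr_ge0 ?sqr_ge0// divr_ge0 ?ltW.
  have : 0 <= (2 * gamma)^-1 * (enorm (w k.+1) - enorm vs) ^+ 2.
    by rewrite mulr_ge0 ?sqr_ge0// invr_ge0 mulr_ge0 ?ltW.
  lra.
move=> /ge_sqr_bound; rewrite invr_gt0 ltr0n => /(_ isT).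
have E4 : (4 : R) = 2 ^+ 2 by ring.
by rewrite invrK E4 (mulrC energy_bound) sqrtrM ?sqr_ge0// sqrtr_sqr ger0_norm//; lra.
Qed.

Lemma averaging_bound k :
  enorm (\sum_(0 <= l < k.+1) (J^T *m consensus_gap l))
  <= rho * (Num.sqrt n%:R * (wnorm W (u 0) + Num.sqrt n%:R * enorm us
                             + Num.sqrt (2 * energy_bound / rho))).
Proof.
have uB : wnorm W (u k.+1)
    <= Num.sqrt n%:R * enorm us + Num.sqrt (2 * energy_bound / rho).
  have -> : 2 * energy_bound / rho = energy_bound / (rho / 2).
    by field; rewrite gt_eqF.
  apply: ge_sqr_bound; first by rewrite divr_gt0.
  apply: le_trans (dual_squares_le k).
  have : 0 <= (2 * gamma)^-1 * (enorm (w k.+1) - enorm vs) ^+ 2.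
    by rewrite mulr_ge0 ?sqr_ge0// invr_ge0 mulr_ge0 ?ltW.
  have := sqr_ge0 (enorm (q k.+1) / 2 - enorm qs); lra.
rewrite sum_gap enormZ gtr0_norm// ler_wpM2l ?(ltW rho_gt0)// -mulmxBr.
apply: le_trans (enorm_avg_le _) _; rewrite ler_wpM2l ?sqrtr_ge0//.
apply: le_trans (_ : wnorm W (u k.+1) + wnorm W (u 0) <= _); last by move: uB; lra.
rewrite -ler_sqr ?nnegrE ?addr_ge0 ?wnorm_ge0// sqr_wnorm ?psd_form_ge0//.
rewrite sqrrD !sqr_wnorm ?psd_form_ge0// mulmxBr !dotlin (psd_formC (u 0) (u k.+1) psdW).
have := psd_form_le (- u 0) (u k.+1) psdW.
have -> : wnorm W (- u 0) = wnorm W (u 0).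
  by rewrite /wnorm !wformE mulmxN dotNl dotNr opprK.
rewrite dotNl (psd_formC (u 0) (u k.+1) psdW); lra.
Qed.

Lemma multiplier_bound k :
  enorm (w k.+1) <= enorm vs + Num.sqrt (2 * gamma * energy_bound).
Proof.
have -> : 2 * gamma * energy_bound = energy_bound / (2 * gamma)^-1.
  by rewrite invrK mulrC.
apply: ge_sqr_bound; first by rewrite invr_gt0 mulr_gt0.
apply: le_trans (dual_squares_le k).
have : 0 <= rho / 2 * (wnorm W (u k.+1) - Num.sqrt n%:R * enorm us) ^+ 2.
  by rewrite mulr_ge0 ?sqr_ge0// divr_ge0 ?ltW.
have := sqr_ge0 (enorm (q k.+1) / 2 - enorm qs); lra.
Qed.

Lemma energy_rates :
  0 <= energy 0 /\ forall k,
  [/\ \sum_(1 <= l < k.+2) (phi l - phis) <= energy 0,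
      forall a, (\sum_(1 <= l < k.+2) s l) a 0
                <= 2 * (enorm qs + Num.sqrt energy_bound),
      enorm (\sum_(0 <= l < k.+1) (J^T *m consensus_gap l))
      <= rho * (Num.sqrt n%:R * (wnorm W (u 0) + Num.sqrt n%:R * enorm us
                                 + Num.sqrt (2 * energy_bound / rho))) &
      enorm (\sum_(1 <= l < k.+2) e l)
      <= (enorm vs + Num.sqrt (2 * gamma * energy_bound)) / gamma].
Proof.
split; first exact: energy0_ge0.
move=> k; split.
- apply: le_trans (energy_telescope k.+1) _.
  by rewrite gerBl energyS_ge0.
- move=> a; apply: le_trans (sum_s_le_queue k.+1 a) _.
  by apply: le_trans (queue_bound k); apply: le_trans (ler_norm _) (coord_le_enorm _ _).
- exact: averaging_bound.
- rewrite ler_pdivlMr// mulrC -(gtr0_norm gamma_gt0) -enormZ sum_e gtr0_norm//.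
  exact: multiplier_bound.
Qed.

End Drift.

(** * The coupled problem *)

Section ProblemFacts.
Context {R : realType} {n : nat} (P : problem R n) (hP : well_formed P).
Implicit Types (x : forall i, 'cV[R]_(dx P i)) (t : 'I_n -> 'cV[R]_(pt P)).

Definition in_dom x := forall i, dom P i (x i).

Definition objective x : R := \sum_i (fo P i (x i) + fine (ho P i (x i))).

Lemma ho_dom i z : dom P i z -> ho P i z = (fine (ho P i z))%:E.
Proof.
rewrite /dom /= => hz; rewrite fineK// fin_numE (wf_ho hP).
by apply/eqP => hy; rewrite hy ltxx in hz.
Qed.

Lemma Fo_dom i z : dom P i z -> Fo z = (fo P i z + fine (ho P i z))%:E.
Proof. by move=> /ho_dom hz; rewrite /Fo {1}hz EFinD. Qed.

Lemma Fo_neqNy i (z : 'cV[R]_(dx P i)) : Fo z != -oo%E.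
Proof. by rewrite /Fo adde_eq_ninfty negb_or wf_ho. Qed.

Lemma sum_Fo_dom x : in_dom x -> (\sum_(i < n) Fo (x i) = (objective x)%:E)%E.
Proof.
by move=> dx; rewrite -sumEFin; apply: eq_bigr => i _; exact: Fo_dom.
Qed.

Lemma sum_Fo_lty x : (\sum_(i < n) Fo (x i) < +oo)%E -> in_dom x.
Proof.
move=> lty i; rewrite /dom /= ltNge leye_eq; apply/negP => /eqP hi.
move: lty; rewrite (bigD1 i)//= /Fo {1}hi addey// addye ?ltxx//.
elim/big_ind: _ => [//|a b an bn|j _]; last exact: Fo_neqNy.
by rewrite adde_eq_ninfty negb_or an.
Qed.

Lemma Phi_stack x t : Phi (stack x t) = (\sum_(i < n) Fo (x i))%E.
Proof. by apply: eq_bigr => i _; rewrite xpart_stack. Qed.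

Lemma sparse_in_notin x i : i \notin Vin P -> sparse_in x i = 0.
Proof. by move=> iV; rewrite /sparse_in (wf_Sin0 hP iV) big_set0. Qed.

Lemma exchange_sparse_in (m : forall j, 'cV[R]_(ps P j)) x :
  \sum_i \sum_(j in Vin P | i \in Sin P j) dot (m j) (gs P j i (x i))
  = \sum_j dot (m j) (sparse_in x j).
Proof.
rewrite (exchange_big_dep (mem (Vin P)))/=; last by move=> i j _ /andP[].
rewrite [RHS](bigID (mem (Vin P)))/= [X in _ + X]big1 ?addr0; last first.
  by move=> j jV; rewrite sparse_in_notin// dot0r.
apply: eq_bigr => j jV; rewrite /sparse_in dot_sumr.
by apply: eq_bigl => i; rewrite jV.
Qed.

Lemma exchange_sparse_eq (m : forall j, 'cV[R]_(ms P j)) x :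
  \sum_i dot (\sum_(j in Veq P | i \in Seq P j) (As P j i)^T *m m j) (x i)
  = \sum_j dot (m j) (sparse_eq x j).
Proof.
under eq_bigr do rewrite dotC dot_sumr.
rewrite (exchange_big_dep (mem (Veq P)))/=; last by move=> i j _ /andP[].
rewrite [RHS](bigID (mem (Veq P)))/= [X in _ + X]big1 ?addr0; last first.
  by move=> j jV; rewrite /sparse_eq (wf_Seq0 hP jV) big_set0 dot0r.
apply: eq_bigr => j jV; rewrite /sparse_eq dot_sumr.
by apply: eq_big => [i|i _]; [rewrite jV|rewrite dotC dot_mull trmxK].
Qed.

Lemma sparse_eqB x x' i :
  sparse_eq (fun i => x i - x' i) i = sparse_eq x i - sparse_eq x' i.
Proof. by rewrite /sparse_eq -sumrB; apply: eq_bigr => j _; rewrite mulmxBr. Qed.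

Lemma feasibleR_stack x t : feasibleR (stack x t) <->
  [/\ forall i, vle (gc P i (x i)) (t i), forall i, vle (sparse_in x i) 0,
      \sum_i Ac P i *m x i = \sum_i bc P i, \sum_i t i = 0 &
      forall i, sparse_eq x i = bs P i].
Proof.
rewrite /feasibleR G_stack B_stack ones_mul Bs_mul /cs.
have -> : \sum_i (Bi P i *m col_mx (x i) (t i) - ci P i)
        = col_mx (\sum_i Ac P i *m x i - \sum_i bc P i) (\sum_i t i).
  rewrite -sumrB; elim/big_rec3: _ => [|i a b d _ ->]; first by rewrite col_mx0.
  rewrite /Bi /ci mul_block_col !mul0mx mul1mx addr0 add0r opp_col_mx !add_col_mx.
  by rewrite subr0.
split=> [[g0 /eqP]|[gt gs Ax t0 sx]].
  rewrite col_mx_eq0 subr_eq0 => /andP[/eqP Ax /eqP t0] /eq_mxcolP sx; split=> //.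
  - move=> i a; rewrite -subr_le0.
    have : (Gi x t i) (lshift _ a) 0 <= 0.
      by apply: mxcol_ge_entry => b; have := g0 b; rewrite [in X in _ <= X -> _]mxE.
    by rewrite /Gi col_mxEu !mxE.
  - move=> i a; rewrite [leRHS]mxE.
    have : (Gi x t i) (rshift _ a) 0 <= 0.
      by apply: mxcol_ge_entry => b; have := g0 b; rewrite [in X in _ <= X -> _]mxE.
    by rewrite /Gi col_mxEd.
split; last by apply/eq_mxcolP.
  move=> b; rewrite [leRHS]mxE [leLHS]mxE.
  move: (tagnat.sig2 b); move: (tagnat.sig1 b) => i a.
  rewrite -(fintype.splitK a); case: (fintype.split a) => {}a /=.
    by rewrite /Gi col_mxEu !mxE subr_le0; exact: gt.
  by rewrite /Gi col_mxEd; have := gs i a; rewrite mxE.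
by rewrite Ax t0 subrr col_mx0.
Qed.

Lemma feasible_of_feasibleR x t : feasibleR (stack x t) -> feasible x.
Proof.
case/feasibleR_stack => gt gs Ax t0 sx; split=> // a.
rewrite [leRHS](_ : _ = (\sum_i t i) a 0); last by rewrite t0.
by rewrite !summxE; apply: ler_sum => i _; exact: gt.
Qed.

(** The slack variables are [g_i(x_i)] recentred to sum to zero. *)
Lemma feasibleR_of_feasible x : feasible x -> exists t, feasibleR (stack x t).
Proof.
case=> g0 Ax gs sx; have n0 : n%:R != 0 :> R by rewrite pnatr_eq0 -lt0n (wf_n hP).
exists (fun i => gc P i (x i) - n%:R^-1 *: \sum_j gc P j (x j)).
apply/feasibleR_stack; split=> //.
- move=> i a; rewrite !mxE lerDl oppr_ge0 mulr_ge0_le0 ?invr_ge0//.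
  by have := g0 a; rewrite [leRHS]mxE.
- move=> i a; have [iV|iV] := boolP (i \in Vin P); first exact: gs.
  by rewrite sparse_in_notin.
- rewrite sumrB sumr_const card_ord -scaler_nat scalerA divff// scale1r subrr//.
- move=> i; have [iV|iV] := boolP (i \in Veq P); first exact: sx.
  by apply/colP => a; have := ltn_ord a; rewrite {2}(wf_ms hP iV).
Qed.

Lemma slater_feasible x : slater x -> feasible x /\ in_dom x.
Proof.
case=> rx [g0 Ax gs sx]; split; last by move=> i; case: (rx i).
by split=> // [a|i iV a]; rewrite ltW// ?g0 ?gs.
Qed.

(** The Slater point makes the optimal value finite. *)
Lemma optimal_dom x : (exists xt : forall i, 'cV[R]_(dx P i), slater xt) ->
  optimal x -> in_dom x.
Proof.
case=> xt /slater_feasible[ft dt] [_ opt]; apply: sum_Fo_lty.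
by apply: le_lt_trans (opt xt ft) _; rewrite sum_Fo_dom// ltry.
Qed.

Lemma optimalR_dom (y : 'cV[R]_(ydim P)) :
  (exists xt : forall i, 'cV[R]_(dx P i), slater xt) ->
  optimalR y -> in_dom (xpart y).
Proof.
case=> xt /slater_feasible[ft dt] [_ opt]; apply: sum_Fo_lty.
have [tt ftt] := feasibleR_of_feasible ft.
by apply: le_lt_trans (opt _ ftt) _; rewrite Phi_stack sum_Fo_dom// ltry.
Qed.

Lemma optimal_values x (y : 'cV[R]_(ydim P)) :
  (exists xt : forall i, 'cV[R]_(dx P i), slater xt) ->
  optimal x -> optimalR y ->
  objective x = objective (xpart y).
Proof.
move=> sl ox oy; have dx := optimal_dom sl ox; have dy := optimalR_dom sl oy.
case: ox oy => fx ox [fy oy]; apply/eqP; rewrite eq_le -!lee_fin -!sum_Fo_dom//.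
apply/andP; split.
  by apply: ox; apply: (@feasible_of_feasibleR _ (tpart y)); rewrite stackK.
have [t ft] := feasibleR_of_feasible fx.
by have := oy _ ft; rewrite Phi_stack.
Qed.

Lemma sqr_sum_le r (I : finType) (A : {set I}) (F : I -> 'cV[R]_r) :
  dot (\sum_(i in A) F i) (\sum_(i in A) F i)
  <= #|A|%:R * \sum_(i in A) dot (F i) (F i).
Proof.
rewrite dot_sumr; under eq_bigr do rewrite dotC dot_sumr.
apply: le_trans (_ : \sum_(i in A) \sum_(j in A)
   (dot (F i) (F i) + dot (F j) (F j)) / 2 <= _).
  apply: ler_sum => i _; apply: ler_sum => j _.
  by have := dotvv_ge0 (F i - F j); rewrite !dotlin (dotC (F j)); lra.
under eq_bigr => i _ do rewrite -mulr_suml big_split/= sumr_const.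
rewrite -mulr_suml big_split/= sumr_const sumrMnl -mulr_natl; lra.
Qed.

Section Lipschitz.
Context (Lg Lgs : R).
Context (hglip : forall i, lip_on (dom P i) Lg (gc P i)).
Context (hgslip : forall i j, i \in Vin P -> j \in Sin P i ->
              lip_on (dom P j) Lgs (gs P i j)).

Lemma sqr_Lconst : Lconst P Lg Lgs ^+ 2 =
  (\max_(i < n) \sum_(j in Vin P | i \in Sin P j) #|Sin P j|)%N%:R * Lgs ^+ 2
  + 1 + Lg ^+ 2.
Proof.
by rewrite /Lconst sqr_sqrtr// !addr_ge0 ?sqr_ge0// mulr_ge0 ?sqr_ge0.
Qed.

(** The slack contributes the summand 1. For the sparse constraints,
    Cauchy--Schwarz over the members of each [Sin P i] costs the factor
    [#|Sin P i|], and node [j] is charged once for each constraint in which it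
    occurs. *)
Lemma G_lipschitz x t x' t' : in_dom x -> in_dom x' ->
  dot (G (stack x t) - G (stack x' t')) (G (stack x t) - G (stack x' t'))
  <= Lconst P Lg Lgs ^+ 2
     * dot (stack x t - stack x' t') (stack x t - stack x' t').
Proof.
move=> dx dx'; rewrite !G_stack stackB -mxcolB dot_mxcol dot_stack.
set dX := \sum_i dot (x i - x' i) _; set dT := \sum_i dot (t i - t' i) _.
pose M := (\max_(i < n) \sum_(j in Vin P | i \in Sin P j) #|Sin P j|)%N.
have hg : \sum_i dot (gc P i (x i) - t i - (gc P i (x' i) - t' i))
                     (gc P i (x i) - t i - (gc P i (x' i) - t' i))
        <= (Lg ^+ 2 + 1) * (dX + dT).
  rewrite -big_split mulr_sumr; apply: ler_sum => i _ /=.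
  have -> : gc P i (x i) - t i - (gc P i (x' i) - t' i)
          = (gc P i (x i) - gc P i (x' i)) - (t i - t' i).
    by rewrite !opprD !opprK addrACA.
  have := hglip (dx i) (dx' i).
  move: (gc P i (x i) - _) (t i - _) (x i - _) => a b d ad.
  have := dot_geN a b; rewrite !dotlin (dotC b a) -!sqr_enorm.
  have := enorm_ge0 a; have := enorm_ge0 b; have := enorm_ge0 d.
  move: ad; move: (enorm a) (enorm b) (enorm d) (dot a b) => p q r s.
  move=> ad r0 q0 p0 ab.
  have h1 : p * q <= Lg * r * q by rewrite ler_wpM2r.
  have h2 : p ^+ 2 <= (Lg * r) ^+ 2 by rewrite ler_sqr ?nnegrE// (le_trans p0).
  have := sqr_ge0 (r - Lg * q); nra.
have hs : \sum_i dot (sparse_in x i - sparse_in x' i) (sparse_in x i - sparse_in x' i)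
        <= M%:R * Lgs ^+ 2 * dX.
  apply: le_trans (_ : \sum_(i in Vin P) #|Sin P i|%:R *
     \sum_(j in Sin P i) Lgs ^+ 2 * dot (x j - x' j) (x j - x' j) <= _).
    rewrite (bigID (mem (Vin P)))/= [X in _ + X]big1 ?addr0; last first.
      by move=> i iV; rewrite !sparse_in_notin// subrr dot0l.
    apply: ler_sum => i iV; rewrite /sparse_in -sumrB.
    apply: le_trans (sqr_sum_le _ _) _; rewrite ler_wpM2l//.
    apply: ler_sum => j jS; rewrite -!sqr_enorm -exprMn.
    have h := hgslip iV jS (dx j) (dx' j).
    by rewrite ler_sqr ?nnegrE ?enorm_ge0// (le_trans _ h) ?enorm_ge0.
  under eq_bigr => i _ do rewrite mulr_sumr.
  rewrite (exchange_big_dep predT)//= mulr_sumr; apply: ler_sum => j _.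
  have D0 : 0 <= Lgs ^+ 2 * dot (x j - x' j) (x j - x' j).
    by rewrite mulr_ge0 ?sqr_ge0 ?dotvv_ge0.
  rewrite -mulr_suml -mulrA ler_wpM2r// -natr_sum ler_nat.
  exact: (leq_bigmax (F := fun j => \sum_(i in Vin P | j \in Sin P i) #|Sin P i|)%N j).
rewrite sqr_Lconst -/M; under eq_bigr => i _.
  rewrite /Gi opp_col_mx add_col_mx dot_col_mx; over.
rewrite big_split/=; have : 0 <= dT by apply: sumr_ge0 => i _; exact: dotvv_ge0.
have : 0 <= M%:R * Lgs ^+ 2 by rewrite mulr_ge0 ?sqr_ge0.
move: hg hs; nra.
Qed.

End Lipschitz.

End ProblemFacts.

(** * The iterates *)

Section Iterates.
Context {R : realType} {n : nat} (P : problem R n) (e : rel 'I_n).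
Context (PW PH : 'M[R]_n) (gamma lambda rho alpha Lf Lg Lgs : R) (it : iterates P).
Context (hP : well_formed P).
Context (hgamma : 0 < gamma) (hlambda : 0 < lambda) (hrho : 0 < rho) (halpha : 0 < alpha).
Context (hLf : 0 < Lf).
Context (hsupp : forall i j, j \notin nbhd e i -> PW i j = 0 /\ PH i j = 0).
Context (hdom : forall i, convex_set (M := 'cV[R]_(dx P i)) (dom P i)).
Context (hfconv : forall i, convex_function (E := 'cV[R]_(dx P i)) (dom P i) (fo P i)).
Context (hhconv : forall i, convex_function (E := 'cV[R]_(dx P i)) (dom P i)
                        (fun x => fine (ho P i x))).
Context (hfdiff : forall i x, dom P i x ->
              differentiable (fo P i : 'cV[R]_(dx P i) -> R^o) x).
Context (hflip : forall i, lip_on (dom P i) Lf (grad (fo P i))).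
Context (hgconv : forall i, convex_vfunction (dom P i) (gc P i)).
Context (hgsconv : forall i j, i \in Vin P -> j \in Sin P i ->
               convex_vfunction (dom P j) (gs P i j)).
Context (hrun : iplux_run e PW PH gamma lambda rho alpha it).

Lemma Wu_full k i : Wu e PW it k i = \sum_j PW i j *: uk it k j.
Proof.
rewrite /Wu [RHS](bigID (mem (nbhd e i)))/= [X in _ + X]big1 ?addr0// => j jN.
by rewrite (hsupp jN).1 scale0r.
Qed.

Lemma Hu_full k i : Hu e PH it k i = \sum_j PH i j *: uk it k j.
Proof.
rewrite /Hu [RHS](bigID (mem (nbhd e i)))/= [X in _ + X]big1 ?addr0// => j jN.
by rewrite (hsupp jN).2 scale0r.
Qed.

Lemma Bi_mul i (x : 'cV[R]_(dx P i)) t :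
  Bi P i *m col_mx x t - ci P i = col_mx (Ac P i *m x - bc P i) t.
Proof.
rewrite /Bi /ci mul_block_col !mul0mx mul1mx addr0 add0r opp_col_mx add_col_mx.
by rewrite subr0.
Qed.

Lemma iter_dom k i : dom P i (xk it k i).
Proof.
elim: k => [|k IH]; first exact: (init_x hrun).
have := step_x hrun k (xk it k i); rewrite /local_objective (ho_dom hP IH) -EFinD.
rewrite /dom /= => le1; rewrite ltNge leye_eq; apply/negP => /eqP hi.
by move: le1; rewrite hi addey// leNgt ltry.
Qed.

Definition wk k j : 'cV[R]_(ms P j) :=
  gamma *: \sum_(1 <= l < k.+1) (sparse_eq (xk it l) j - bs P j).

(** This is what makes the algorithm a method of multipliers: the [v_i] start
    at 0 and only accumulate images of the residuals. *)
Lemma vxkE k i : vxk it k i =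
  \sum_(j in Veq P | i \in Seq P j) (As P j i)^T *m wk k j.
Proof.
elim: k => [|k IH].
  rewrite (init_vx hrun) big1// => j _.
  by rewrite /wk big_geq// scaler0 mulmx0.
rewrite (step_vx hrun) IH /rk scaler_sumr -big_split; apply: eq_bigr => j _ /=.
by rewrite scalemxAr -mulmxDr /wk [in RHS]big_nat_recr//= [in RHS]scalerDr.
Qed.

Lemma queue_entry_ge0 k i a : 0 <= qk it k i a 0 + sk it k i a 0.
Proof.
by case: k => [|k]; [rewrite (init_q hrun)|rewrite (step_q hrun)];
  rewrite !mxE -lerBlDr sub0r le_max lexx.
Qed.

(** The objective of node [i] is split for [prox_optimality]; [f_i] occurs only
    through its linearization, which belongs to the quadratic part. *)
Definition convex_part k i (z : 'cV[R]_(dx P i)) : R :=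
  fine (ho P i z) + (dot (usubmx (qk it k i) + usubmx (sk it k i)) (gc P i z)
   + \sum_(j in Vin P | i \in Sin P j)
        dot (dsubmx (qk it k j) + dsubmx (sk it k j)) (gs P j i z)).

Definition quadratic_part k i (z : 'cV[R]_(dx P i)) : R :=
  dot (grad (fo P i) (xk it k i)) (z - xk it k i) + dot (vxk it k i) z
  + gamma * lambda ^+ 2 / 2
      * enorm (z - xk it k i + (lambda ^+ 2)^-1 *: rk it k i) ^+ 2
  + (2 * rho)^-1 * enorm (Ac P i *m z - bc P i) ^+ 2
  + dot (usubmx (Wu e PW it k i) - rho^-1 *: usubmx (zk it k i))
        (Ac P i *m z - bc P i)
  + alpha / 2 * enorm (z - xk it k i) ^+ 2.

Lemma local_objectiveE k i z : dom P i z ->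
  local_objective P e PW gamma lambda rho alpha it k i z
  = (convex_part k z + quadratic_part k z)%:E.
Proof.
move=> dz; rewrite /local_objective (ho_dom hP dz) -EFinD; congr (_%:E).
by rewrite /convex_part /quadratic_part; ring.
Qed.

Lemma convex_convex_part k i :
  convex_function (E := 'cV[R]_(dx P i)) (dom P i) (@convex_part k i).
Proof.
apply: convex_functionD => //; apply: convex_functionD.
  by apply: convex_function_dot => // a;
    rewrite mxE [X in X + _]mxE [X in _ + X]mxE queue_entry_ge0.
apply: convex_function_sum => j /andP[jV iS].
apply: convex_function_dot; last exact: hgsconv.
by move=> a; rewrite mxE [X in X + _]mxE [X in _ + X]mxE queue_entry_ge0.
Qed.

Lemma usubmx_uS k i : usubmx (uk it k.+1 i)
  = rho^-1 *: (Ac P i *m xk it k.+1 i - bc P i - usubmx (zk it k i))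
    + usubmx (Wu e PW it k i).
Proof.
rewrite (step_u hrun) Bi_mul linearD linearZ /= linearB /=.
by rewrite col_mxKu.
Qed.

Lemma dsubmx_uS k i : dsubmx (uk it k.+1 i)
  = rho^-1 *: (tk it k.+1 i - dsubmx (zk it k i)) + dsubmx (Wu e PW it k i).
Proof.
rewrite (step_u hrun) Bi_mul linearD linearZ /= linearB /=.
by rewrite col_mxKd.
Qed.

(** The derivative of the quadratic part at the new iterate; the terms coming
    from the coupled equality collect into the updated [u_i]. *)
Definition slope k i (d : 'cV[R]_(dx P i)) : R :=
  dot (grad (fo P i) (xk it k i)) d
  + dot (vxk it k i + gamma *: rk it k i) d
  + (gamma * lambda ^+ 2 + alpha) * dot (xk it k.+1 i - xk it k i) d
  + dot (usubmx (uk it k.+1 i)) (Ac P i *m d).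

Lemma quadratic_part_line k i (d : 'cV[R]_(dx P i)) t :
  quadratic_part k (xk it k.+1 i + t *: d)
  = quadratic_part k (xk it k.+1 i) + t * slope k d
    + t ^+ 2 * ((gamma * lambda ^+ 2 + alpha) / 2 * dot d d
                + (2 * rho)^-1 * dot (Ac P i *m d) (Ac P i *m d)).
Proof.
rewrite /slope usubmx_uS /quadratic_part !sqr_enorm mulmxDr -scalemxAr.
rewrite -!(addrAC _ (- _) (t *: _)).
move: (grad _ _) (vxk _ _ _) (rk _ _ _) => g v r.
move: (Ac P i *m xk it k.+1 i - bc P i) (Ac P i *m d) => p b.
move: (usubmx (Wu _ _ _ _ _)) (usubmx (zk _ _ _)) => w z.
have -> : dot v (xk it k.+1 i + t *: d) = dot v (xk it k.+1 i) + t * dot v d.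
  by rewrite dotDr dotZr.
move: (dot v (xk it k.+1 i)) (xk it k.+1 i - xk it k i) => vx m.
rewrite !dotlin (dotC d m) (dotC r m) (dotC r d) (dotC b p); field.
by rewrite !gt_eqF.
Qed.

Lemma node_step k i (x : 'cV[R]_(dx P i)) : dom P i x ->
  fo P i (xk it k.+1 i) + convex_part k (xk it k.+1 i)
  <= fo P i x + convex_part k x
     + (dot (vxk it k i + gamma *: rk it k i) (x - xk it k.+1 i)
        + (gamma * lambda ^+ 2 + alpha)
          * dot (xk it k.+1 i - xk it k i) (x - xk it k.+1 i)
        + dot (usubmx (uk it k.+1 i)) (Ac P i *m (x - xk it k.+1 i)))
     + Lf / 2 * dot (xk it k.+1 i - xk it k i) (xk it k.+1 i - xk it k i).
Proof.
move=> dx; have dp := iter_dom k.+1 i; have d0 := iter_dom k i.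
have opt : convex_part k (xk it k.+1 i)
    <= convex_part k x + slope k (x - xk it k.+1 i).
  refine (@prox_optimality _ _ (dom P i) (convex_part k (i:=i))
    (quadratic_part k (i:=i)) _ _ _ _ (@convex_convex_part k i) dp dx _ _ _).
  - by move=> t t01; exact: (convex_setP (@hdom i)).
  - by move=> t; exact: quadratic_part_line.
  - move=> z dz; have := step_x hrun k z.
    by rewrite !local_objectiveE.
have up := descent (@hdom i) (@hfdiff i) (@hflip i) d0 dp.
have low := grad_le (@hfconv i) d0 dx (hfdiff d0).
move: opt up low; rewrite /slope sqr_enorm.
have -> : dot (grad (fo P i) (xk it k i)) (x - xk it k i)
   = dot (grad (fo P i) (xk it k i)) (x - xk it k.+1 i)
     + dot (grad (fo P i) (xk it k i)) (xk it k.+1 i - xk it k i).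
  by rewrite -dotDr subrKA.
move: (dot (grad _ _) _) (dot (grad _ _) _) => a b; lra.
Qed.

(** The update of [t_i] is explicit, so its optimality is an equality. *)
Lemma slack_step k i (t : 'cV[R]_(pt P)) :
  - dot (usubmx (qk it k i) + usubmx (sk it k i)) (tk it k.+1 i)
  = - dot (usubmx (qk it k i) + usubmx (sk it k i)) t
    + (gamma * lambda ^+ 2 + alpha)
      * dot (tk it k.+1 i - tk it k i) (t - tk it k.+1 i)
    + dot (dsubmx (uk it k.+1 i)) (t - tk it k.+1 i).
Proof.
rewrite dsubmx_uS.
set D := rho^-1 + gamma * lambda ^+ 2 + alpha.
have gl0 : 0 <= gamma * lambda ^+ 2 by rewrite mulr_ge0 ?sqr_ge0 ?ltW.
have D0 : D != 0.
  by rewrite gt_eqF// /D -addrA addr_gt0 ?invr_gt0// ltr_wpDl.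
have tE : D *: tk it k.+1 i =
   (gamma * lambda ^+ 2 + alpha) *: tk it k i - dsubmx (Wu e PW it k i)
   + rho^-1 *: dsubmx (zk it k i) + usubmx (qk it k i) + usubmx (sk it k i).
  by rewrite (step_t hrun) scalerA divff// scale1r.
have := congr1 (fun v => dot v (t - tk it k.+1 i)) tE.
move: (tk it k.+1 i) (tk it k i) (dsubmx _) (dsubmx _) (usubmx _) (usubmx _).
move=> t1 t0 w z q s; rewrite /D !dotlin; lra.
Qed.

Definition wstack k : 'cV[R]_(vdim P) := \mxcol_j wk k j.
Definition residual k : 'cV[R]_(vdim P) := Bs P *m ystack it k - cs P.

Lemma residualE k : residual k = \mxcol_j (sparse_eq (xk it k) j - bs P j).
Proof. exact: Bs_stack. Qed.

Lemma wstackS k : wstack k.+1 = wstack k + gamma *: residual k.+1.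
Proof.
rewrite residualE; apply/mxcolP => j.
rewrite submxcolD !mxcolK /wk big_nat_recr//= scalerDr; congr (_ + _).
rewrite -{1}(mxcolK (fun j => sparse_eq (xk it k.+1) j - bs P j) j).
by apply/colP => a; rewrite !mxE.
Qed.

Lemma sum_convex_part k (x : forall i, 'cV[R]_(dx P i)) t :
  \sum_i (fo P i (x i) + convex_part k (x i))
  - \sum_i dot (usubmx (qk it k i) + usubmx (sk it k i)) (t i)
  = objective x + dot (qstack it k + G (ystack it k)) (G (stack x t)).
Proof.
rewrite !G_stack -mxcolD dot_mxcol.
under [\sum_i dot _ (Gi _ _ _)]eq_bigr => i _.
  rewrite /Gi -[qk it k i]vsubmxK -[col_mx (gc P i (xk it k i) - _) _]/(sk it k i).
  rewrite -[sk it k i]vsubmxK add_col_mx dot_col_mx dotBr; over.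
rewrite /= !big_split/= -(exchange_sparse_in hP) /convex_part /objective !big_split/=.
rewrite sumrN; lra.
Qed.

(** Summing [node_step] and [slack_step] over the nodes and exchanging the two
    sums regroups, constraint by constraint, the terms that each sparse
    constraint contributes to the objectives of several nodes. *)
Lemma primal_step k (x : forall i, 'cV[R]_(dx P i)) t :
  in_dom x -> (forall j, sparse_eq x j = bs P j) ->
  objective (xk it k.+1)
  + dot (qstack it k + G (ystack it k)) (G (ystack it k.+1))
  <= objective x + dot (qstack it k + G (ystack it k)) (G (stack x t))
     - dot (wstack k + gamma *: residual k) (residual k.+1)
     + (gamma * lambda ^+ 2 + alpha)
       * dot (ystack it k.+1 - ystack it k) (stack x t - ystack it k.+1)
     + dot (ustack it k.+1)
           ((B P *m stack x t - c P) - (B P *m ystack it k.+1 - c P))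
     + Lf / 2 * dot (ystack it k.+1 - ystack it k) (ystack it k.+1 - ystack it k).
Proof.
move=> xD xs; rewrite -!sum_convex_part.
have hv : \sum_i dot (vxk it k i + gamma *: rk it k i) (x i - xk it k.+1 i)
        = - dot (wstack k + gamma *: residual k) (residual k.+1).
  rewrite !residualE [_ + gamma *: _](_ : _ = \mxcol_j (wk k j
      + gamma *: (sparse_eq (xk it k) j - bs P j))); last first.
    by apply/matrixP => a b; rewrite !mxE.
  pose m j := wk k j + gamma *: (sparse_eq (xk it k) j - bs P j).
  rewrite dot_mxcol -sumrN -/m.
  under [RHS]eq_bigr => j _ do rewrite -/(m j) -dotNr opprB -xs -sparse_eqB.
  rewrite -(exchange_sparse_eq hP); apply: eq_bigr => i _; congr (dot _ _).
  rewrite vxkE /rk scaler_sumr -big_split; apply: eq_bigr => j _ /=.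
  by rewrite scalemxAr -mulmxDr.
have hu : \sum_i (dot (usubmx (uk it k.+1 i)) (Ac P i *m (x i - xk it k.+1 i))
                   + dot (dsubmx (uk it k.+1 i)) (t i - tk it k.+1 i))
        = dot (ustack it k.+1)
           ((B P *m stack x t - c P) - (B P *m ystack it k.+1 - c P)).
  rewrite !B_stack -mxcolB dot_mxcol; apply: eq_bigr => i _.
  rewrite !Bi_mul opp_col_mx add_col_mx -{3}[uk it k.+1 i]vsubmxK dot_col_mx.
  by rewrite mulmxBr opprB addrA subrK.
have hL : 0 <= Lf / 2
    * \sum_i dot (tk it k.+1 i - tk it k i) (tk it k.+1 i - tk it k i).
  by rewrite mulr_ge0 ?(divr_ge0 (ltW hLf))// sumr_ge0// => i _; exact: dotvv_ge0.
have /= hN := ler_sum (index_enum 'I_n) (fun i (_ : true) => node_step k (xD i)).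
have := eq_bigr _ (fun (i : 'I_n) (_ : true) => slack_step k i (t i)).
move=> /(_ 0 +%R (index_enum 'I_n)) /= hS.
rewrite -hv -hu !stackB !dot_stack.
move: hN hS hL; rewrite !big_split/= !sumrN -!mulr_sumr.
lra.
Qed.

Lemma vmax_mxcol (p_ : 'I_n -> nat) (a b : forall i, 'cV[R]_(p_ i)) :
  vmax (\mxcol_i a i) (\mxcol_i b i) = \mxcol_i vmax (a i) (b i).
Proof. by apply/matrixP => j l; rewrite !mxE. Qed.

Lemma qstack0 : qstack it 0 = vmax (- G (ystack it 0)) 0.
Proof.
rewrite G_stack -mxcolN -mxcol0 vmax_mxcol; apply: eq_mxcol => i.
exact: (init_q hrun).
Qed.

Lemma qstackS k : qstack it k.+1
  = vmax (- G (ystack it k.+1)) (qstack it k + G (ystack it k.+1)).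
Proof.
rewrite G_stack -mxcolN -mxcolD vmax_mxcol; apply: eq_mxcol => i.
exact: (step_q hrun).
Qed.

Lemma zstack0 : zstack it 0 = kronI P PH *m (rho *: ustack it 0).
Proof.
rewrite -scalemxAr kronI_mul; apply/mxcolP => i.
rewrite mxcolK (init_z hrun) Hu_full.
rewrite -[X in rho *: X](mxcolK (fun i => \sum_j PH i j *: uk it 0 j) i).
by apply/colP => a; rewrite !mxE.
Qed.

Lemma zstackS k :
  zstack it k.+1 = zstack it k + rho *: (kronI P PH *m ustack it k.+1).
Proof.
rewrite kronI_mul; apply/matrixP => a b; rewrite [LHS]mxE (step_z hrun) Hu_full.
rewrite [RHS]mxE [X in _ = X + _]mxE [X in _ = _ + X]mxE.
by rewrite [X in _ = _ + rho * X]mxE 2!mxE.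
Qed.

Lemma gap_stack k : B P *m ystack it k.+1 - c P
  = rho *: ustack it k.+1 - rho *: (kronI P PW *m ustack it k) + zstack it k.
Proof.
rewrite B_stack kronI_mul; apply/mxcolP => i.
rewrite mxcolK submxcolD submxcolB.
have sZ (v : 'cV[R]_(udim P)) : submxcol (rho *: v) i = rho *: submxcol v i.
  by apply/colP => a; rewrite !mxE.
rewrite !sZ !mxcolK -Wu_full (step_u hrun) scalerDr scalerA divff ?gt_eqF// scale1r.
by rewrite addrK subrK.
Qed.

Context (ystar : 'cV[R]_(ydim P)) (qstar : 'cV[R]_(qdim P)).
Context (ustar : 'cV[R]_(mt P + pt P)) (vstar : 'cV[R]_(vdim P)).
Context (hpsdW : psd PW) (hpsdH : psd PH).
Context (hW1 : PW *m const_mx 1 = const_mx 1 :> 'cV[R]_n).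
Context (hnullH : forall x : 'cV[R]_n,
  PH *m x = 0 <-> exists a : R, x = a *: const_mx 1).
Context (hWH : psd (1%:M - (PW + PH))).
Context (hglip : forall i, lip_on (dom P i) Lg (gc P i)).
Context (hgslip : forall i j, i \in Vin P -> j \in Sin P i ->
              lip_on (dom P j) Lgs (gs P i j)).
Context (hslater : exists xt : forall i, 'cV[R]_(dx P i), slater xt).
Context (hystar : optimalR ystar).
Context (hmult : geometric_multiplier ystar qstar ustar vstar).
Context (hLalpha : Lf + Lconst P Lg Lgs ^+ 2 <= alpha).
Context (hLlambda : spectral_norm (Bs P) <= lambda).

Lemma sqr_Bs_le (v : 'cV[R]_(ydim P)) :
  dot (Bs P *m v) (Bs P *m v) <= lambda ^+ 2 * dot v v.
Proof.
rewrite -!sqr_enorm -exprMn ler_sqr ?nnegrE ?enorm_ge0//; last first.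
  by rewrite mulr_ge0 ?enorm_ge0// ltW.
by apply: le_trans (spectral_norm_bound _ _) _; rewrite ler_wpM2r ?enorm_ge0.
Qed.

Lemma Phi_ystar : Phi ystar = (objective (xpart ystar))%:E.
Proof.
by rewrite -{1}(stackK ystar) Phi_stack sum_Fo_dom//; exact: optimalR_dom.
Qed.

Lemma saddle_stack x t : in_dom x ->
  objective (xpart ystar)
  <= objective x + dot qstar (G (stack x t))
     + dot ustar ((ones_kronI P)^T *m (B P *m stack x t - c P))
     + dot vstar (Bs P *m stack x t - cs P).
Proof.
move=> xD; case: hmult => _ _ /(_ (stack x t)).
rewrite Phi_ystar /lagrangian Phi_stack sum_Fo_dom// -EFinD lee_fin; lra.
Qed.

Lemma zstar_avg : (ones_kronI P)^T *m (B P *m ystar - c P) = 0.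
Proof. by case: hystar => [[]]. Qed.

Lemma kronH_ones : kronI P PH *m ones_kronI P = 0.
Proof.
have H1 : PH *m const_mx 1 = 0 *: const_mx 1 :> 'cV[R]_n.
  by rewrite scale0r; apply/hnullH; exists 1; rewrite scale1r.
by rewrite (kronI_ones P H1) scale0r.
Qed.

Lemma ones_kronH (v : 'cV[R]_(udim P)) : (ones_kronI P)^T *m (kronI P PH *m v) = 0.
Proof.
have [Ht _] := psd_kronI P hpsdH.
by rewrite mulmxA -{1}Ht -trmx_mul kronH_ones trmx0 mul0mx.
Qed.

(** Both [z] at time 0 and its optimal value have zero average over the nodes. *)
Lemma zeta0_ex : exists zeta0,
  kronI P PH *m zeta0 = zstack it 0 - (B P *m ystar - c P).
Proof.
apply: kronI_range => //; first exact: (wf_n hP).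
by rewrite mulmxBr zstar_avg zstack0 ones_kronH subrr.
Qed.

Lemma vstack0 : vstack it 0 = 0.
Proof.
rewrite /vstack -(stack0 P); apply: eq_mxcol => i.
by rewrite (init_vx hrun).
Qed.

Let vq := Vq PW PH gamma lambda rho alpha it ystar qstar ustar vstar.
Let vu := Vu PW PH gamma lambda rho alpha it ystar qstar ustar vstar.
Let vv := Vv PW PH gamma lambda rho alpha it ystar qstar ustar vstar.
Let r0 := R0 PW PH gamma lambda rho alpha it ystar.

Lemma stack_rates : 0 <= r0 /\ forall k,
  [/\ \sum_(1 <= l < k.+2) (objective (xk it l) - objective (xpart ystar)) <= r0,
      forall a, (\sum_(1 <= l < k.+2) G (ystack it l)) a 0 <= vq,
      enorm (\sum_(1 <= l < k.+2)
               ((ones_kronI P)^T *m (B P *m ystack it l - c P))) <= rho * vu &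
      enorm (\sum_(1 <= l < k.+2) (Bs P *m ystack it l - cs P)) <= vv / gamma].
Proof.
have [zeta0 Hzeta0] := zeta0_ex.
pose zeta k : 'cV[R]_(udim P) := zeta0 + rho *: \sum_(1 <= l < k.+1) ustack it l.
have zetaS k : zeta k.+1 = zeta k + rho *: ustack it k.+1.
  by rewrite /zeta big_nat_recr//= scalerDr addrA.
have Hzeta k : kronI P PH *m zeta k = zstack it k - (B P *m ystar - c P).
  elim: k => [|k IH].
    by rewrite /zeta big_geq// scaler0 addr0 Hzeta0.
  by rewrite zetaS mulmxDr IH -scalemxAr zstackS addrAC.
have gapE k : consensus_gap rho (kronI P PW) (kronI P PH) (ustack it) zeta k
    = (B P *m ystack it k.+1 - c P) - (B P *m ystar - c P).
  by rewrite /consensus_gap Hzeta gap_stack addrA.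
have yD := optimalR_dom hP hslater hystar.
have [Gy _ _] : feasibleR (stack (xpart ystar) (tpart ystar)).
  by rewrite stackK; case: hystar.
have /feasibleR_stack[_ _ _ _ sxy] : feasibleR (stack (xpart ystar) (tpart ystar)).
  by rewrite stackK; case: hystar.
have W1 : kronI P PW *m ones_kronI P = ones_kronI P.
  by rewrite (@kronI_ones _ _ _ _ 1) ?scale1r.
have wh : psd (1%:M - (kronI P PW + kronI P PH)).
  by rewrite -kronID; exact: psd_1_sub_kronI.
have elip k : dot (residual k.+1 - residual k) (residual k.+1 - residual k)
   <= lambda ^+ 2
      * dot (ystack it k.+1 - ystack it k) (ystack it k.+1 - ystack it k).
  by rewrite /residual opprB addrA subrK -mulmxBr sqr_Bs_le.
have slip k :
   dot (G (ystack it k.+1) - G (ystack it k)) (G (ystack it k.+1) - G (ystack it k))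
   <= Lconst P Lg Lgs ^+ 2
      * dot (ystack it k.+1 - ystack it k) (ystack it k.+1 - ystack it k).
  by apply: G_lipschitz => // i; exact: iter_dom.
have slips k : dot (G (ystack it k) - G ystar) (G (ystack it k) - G ystar)
   <= Lconst P Lg Lgs ^+ 2 * dot (ystack it k - ystar) (ystack it k - ystar).
  rewrite -(stackK ystar); apply: G_lipschitz => // i; exact: iter_dom.
have step k : objective (xk it k.+1)
   + dot (qstack it k + G (ystack it k)) (G (ystack it k.+1))
  <= objective (xpart ystar) + dot (qstack it k + G (ystack it k)) (G ystar)
     - dot (wstack k + gamma *: residual k) (residual k.+1)
     + (gamma * lambda ^+ 2 + alpha)
       * dot (ystack it k.+1 - ystack it k) (ystar - ystack it k.+1)
     - dot (ustack it k.+1)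
        (consensus_gap rho (kronI P PW) (kronI P PH) (ustack it) zeta k)
     + Lf / 2 * dot (ystack it k.+1 - ystack it k) (ystack it k.+1 - ystack it k).
  have := primal_step k (tpart ystar) yD sxy.
  by rewrite stackK gapE -[_ - _ - (B P *m ystack it k.+1 - c P)]opprB dotNr.
have w0 : wstack 0 = 0.
  by rewrite /wstack -mxcol0; apply: eq_mxcol => j; rewrite /wk big_geq// scaler0.
have JgapE k : (ones_kronI P)^T *m
      consensus_gap rho (kronI P PW) (kronI P PH) (ustack it) zeta k
    = (ones_kronI P)^T *m (B P *m ystack it k.+1 - c P).
  by rewrite gapE mulmxBr zstar_avg subr0.
have sad k : objective (xpart ystar) <= objective (xk it k.+1)
   + dot qstar (G (ystack it k.+1))
   + dot ustar ((ones_kronI P)^T *m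
      consensus_gap rho (kronI P PW) (kronI P PH) (ustack it) zeta k)
   + dot vstar (residual k.+1).
  by rewrite JgapE; apply: saddle_stack => i; exact: iter_dom.
have q0 : vle 0 qstar by case: hmult.
have Gy0 : vle (G ystar) 0 by rewrite -(stackK ystar).
have := energy_rates (s := fun k => G (ystack it k))
  (phi := fun k => objective (xk it k)) hgamma hrho (ltW halpha) (ltW hLf) hLalpha
  (psd_kronI P hpsdW) (psd_kronI P hpsdH) wh W1 kronH_ones (ones_ones P)
  w0 wstackS qstack0 qstackS zetaS Gy0 elip slip slips step q0 sad.
have v0 : wnorm (Mdag P) (vstack it 0) = 0.
  by rewrite vstack0 /wnorm wformE dot0l sqrtr0.
have E0 : energy gamma lambda rho alpha (kronI P PW) (kronI P PH) (ystack it)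
    (ustack it) zeta (qstack it) (fun k => G (ystack it k)) wstack ystar 0 = r0.
  have [HXH _ _ _] := mpinvP (kronI P PH).
  have zE : dot (kronI P PH *m zeta 0%N)
       (mpinv (kronI P PH) *m (kronI P PH *m zeta 0%N))
     = dot (zeta 0%N) (kronI P PH *m zeta 0%N).
    by rewrite dot_mull (proj1 (psd_kronI P hpsdH)) !mulmxA HXH.
  rewrite /energy /r0 /R0 v0 w0 dot0l -Hzeta.
  have := psd_kronI P hpsdH; have := psd_kronI P hpsdW => pW pH.
  rewrite !sqr_wnorm ?zE ?psd_form_ge0// !sqr_enorm; field.
  by rewrite !gt_eqF.
have EC : energy_bound (n := n) gamma lambda rho alpha (kronI P PW) (kronI P PH)
    (ystack it) (ustack it) zeta (qstack it) (fun k => G (ystack it k))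
    wstack ystar (G ystar) qstar ustar vstar
  = Cconst PW PH gamma lambda rho alpha it ystar qstar ustar vstar.
  by rewrite /energy_bound E0 /Cconst -/r0 v0 mulr0 addr0.
rewrite E0 EC; case=> r0_ge0 rates; split=> // k; have [h1 h2 h3 h4] := rates k.
split=> //.
  by rewrite big_add1 /=; under eq_bigr do rewrite -JgapE; exact: h3.
by rewrite /vv /Vv v0 add0r.
Qed.

Definition tbar k i : 'cV[R]_(pt P) := mean (fun l => tk it l i) k.
Definition ybar k : 'cV[R]_(ydim P) := stack (xbar it k) (tbar k).

Lemma ybarE k : ybar k = mean (ystack it) k.
Proof.
apply/matrixP => a b; rewrite /ybar /stack /tbar /xbar /mean [LHS]mxE [RHS]mxE.
rewrite summxE; under [in RHS]eq_bigr do rewrite mxE.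
move: (tagnat.sig2 a); move: (tagnat.sig1 a) => i {}a.
rewrite -(fintype.splitK a); case: (fintype.split a) => {}a /=.
  by rewrite col_mxEu mxE summxE; under [in RHS]eq_bigr do rewrite col_mxEu.
by rewrite col_mxEd mxE summxE; under [in RHS]eq_bigr do rewrite col_mxEd.
Qed.

Lemma affine_mean r s (A : 'M[R]_(r, s)) (d : 'cV[R]_r) (v : nat -> 'cV[R]_s) k :
  A *m mean v k.+1 - d = k.+1%:R^-1 *: \sum_(1 <= l < k.+2) (A *m v l - d).
Proof.
rewrite /mean sumrB -scalemxAr mulmx_sumr scalerBr; congr (_ - _).
rewrite big_const_nat iter_addr_0 subn1 /= -[d *+ _]scaler_nat scalerA.
by rewrite mulVf ?scale1r// pnatr_eq0.
Qed.

Lemma xbar_dom k i : dom P i (xbar it k.+1 i).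
Proof.
apply: (convex_mean (s := fun l => xk it l i) (@hdom i)) => // l.
exact: iter_dom.
Qed.

Lemma objective_xbar k :
  k.+1%:R * objective (xbar it k.+1) <= \sum_(1 <= l < k.+2) objective (xk it l).
Proof.
rewrite /objective mulr_sumr exchange_big; apply: ler_sum => i _.
have cF : convex_function (E := 'cV[R]_(dx P i)) (dom P i)
    (fun z => fo P i z + fine (ho P i z)) by exact: convex_functionD.
by have := jensen_mean (s := fun l => xk it l i) (@hdom i) cF
  (fun l => iter_dom l i) (ltn0Sn k).
Qed.

Lemma G_ybar k a :
  k.+1%:R * (G (ybar k.+1)) a 0 <= (\sum_(1 <= l < k.+2) G (ystack it l)) a 0.
Proof.
rewrite summxE G_stack mxE; under eq_bigr do rewrite G_stack mxE.
move: (tagnat.sig2 a); move: (tagnat.sig1 a) => i {}a.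
have k0 : k.+1%:R != 0 :> R by rewrite pnatr_eq0.
rewrite -(fintype.splitK a); case: (fintype.split a) => {}a /=.
  under eq_bigr do rewrite /Gi col_mxEu !mxE.
  rewrite /Gi col_mxEu !mxE sumrB mulrBr lerB//.
    exact: (jensen_mean (s := fun l => xk it l i) (@hdom i) (@hgconv i a)
      (fun l => iter_dom l i) (ltn0Sn k)).
  by rewrite summxE mulrA divff// mul1r.
under eq_bigr do rewrite /Gi col_mxEd /sparse_in summxE.
rewrite /Gi col_mxEd /sparse_in summxE mulr_sumr exchange_big.
apply: ler_sum => j jS.
have iV : i \in Vin P.
  by apply: contraLR jS => /(wf_Sin0 hP) ->; rewrite inE.
exact: (jensen_mean (s := fun l => xk it l j) (@hdom j) (hgsconv iV jS a)
      (fun l => iter_dom l j) (ltn0Sn k)).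
Qed.

(** The accumulated residuals are divided by [k]: the equality residuals are
    affine, and for the inequalities and the objective Jensen's inequality
    applies. The coupled inequality also pays for the sum of the slacks, which
    is the lower block of the summed equality residual. *)
Lemma averaged_rates (xstar : forall i, 'cV[R]_(dx P i)) : optimal xstar ->
  [/\ 0 <= vq, 0 <= vu, 0 <= vv,
      0 <= RPhi PW PH gamma lambda rho alpha it ystar qstar ustar vstar & 0 <= r0] /\
  forall k : nat, (1 <= k)%N ->
  [/\ vle (\sum_i gc P i (xbar it k i)) (const_mx ((n%:R * vq + rho * vu) / k%:R)),
      forall i, i \in Vin P -> vle (sparse_in (xbar it k) i) (const_mx (vq / k%:R)),
      enorm (\sum_i (Ac P i *m xbar it k i - bc P i)) <= rho * vu / k%:R,
      forall i, i \in Veq P ->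
        enorm (sparse_eq (xbar it k) i - bs P i) <= vv / (gamma * k%:R) &
      ((- (RPhi PW PH gamma lambda rho alpha it ystar qstar ustar vstar / k%:R))%:E
         <= \sum_(i < n) (Fo (xbar it k i) - Fo (xstar i))
         <= (r0 / k%:R)%:E)%E].
Proof.
move=> hxstar; have [r0_ge0 rates] := stack_rates.
have qs0 : vle 0 qstar by case: hmult.
have one_qs0 : 0 <= dot (const_mx 1) qstar.
  rewrite dotE sumr_ge0// => a _; rewrite mxE mul1r.
  by have := qs0 a; rewrite mxE.
have vq0 : 0 <= vq by rewrite mulr_ge0 ?addr_ge0 ?enorm_ge0 ?sqrtr_ge0.
have vu0 : 0 <= vu.
  by rewrite mulr_ge0 ?addr_ge0 ?wnorm_ge0 ?mulr_ge0 ?enorm_ge0 ?sqrtr_ge0.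
have vv0 : 0 <= vv by rewrite !addr_ge0 ?wnorm_ge0 ?enorm_ge0 ?sqrtr_ge0.
split.
  split=> //; rewrite /RPhi -/vq -/vu -/vv !addr_ge0//.
  - by rewrite mulr_ge0.
  - by rewrite mulr_ge0 ?enorm_ge0// mulr_ge0 ?(ltW hrho).
  - by rewrite divr_ge0 ?(ltW hgamma)// mulr_ge0 ?enorm_ge0.
case=> // k _; have [sum_obj sum_G sum_avg sum_eq] := rates k.
set K : R := k.+1%:R; have K0 : 0 < K by rewrite ltr0n.
have Ki0 : 0 <= K^-1 by rewrite invr_ge0 ltW.
have GK a : G (ybar k.+1) a 0 <= vq / K.
  by rewrite ler_pdivlMr// mulrC; apply: le_trans (G_ybar k a) (sum_G a).
have avgK : enorm ((ones_kronI P)^T *m (B P *m ybar k.+1 - c P)) <= rho * vu / K.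
  rewrite ybarE affine_mean -scalemxAr enormZ ger0_norm//.
  by rewrite mulmx_sumr mulrC ler_wpM2r.
have eqK : enorm (Bs P *m ybar k.+1 - cs P) <= vv / (gamma * K).
  rewrite ybarE affine_mean enormZ ger0_norm//.
  by rewrite invfM mulrA mulrC ler_wpM2r.
have avgE : (ones_kronI P)^T *m (B P *m ybar k.+1 - c P)
    = col_mx (\sum_i (Ac P i *m xbar it k.+1 i - bc P i)) (\sum_i tbar k.+1 i).
  rewrite /ybar B_stack ones_mul; under eq_bigr do rewrite Bi_mul.
  by elim/big_rec3: _ => [|i a b d _ ->]; rewrite ?col_mx0// add_col_mx.
have xD : in_dom (xbar it k.+1) by move=> i; exact: xbar_dom.
split.
- move=> a; rewrite [leRHS]mxE -/K mulrDl.
  have tK : (\sum_i tbar k.+1 i) a 0 <= rho * vu / K.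
    apply: le_trans avgK; rewrite avgE.
    apply: le_trans (ler_norm _) _; apply: le_trans (coord_le_enorm _ _) _.
    by apply: le_trans (enorm_dsubmx_le _); rewrite col_mxKd.
  apply: le_trans (_ : n%:R * (vq / K) + (\sum_i tbar k.+1 i) a 0 <= _); last first.
    by rewrite mulrA lerD2l.
  rewrite !summxE -lerBlDr -sumrB.
  have -> : n%:R * (vq / K) = \sum_(i < n) vq / K.
    by rewrite sumr_const card_ord mulr_natl.
  apply: ler_sum => i _.
  have := @mxcol_ge_entry R n _ (Gi (xbar it k.+1) (tbar k.+1)) (vq / K) i (lshift _ a).
  rewrite /Gi col_mxEu !mxE; apply => b; have := GK b.
  by rewrite /ybar G_stack.
- move=> i iV a; rewrite [leRHS]mxE -/K.
  have := @mxcol_ge_entry R n _ (Gi (xbar it k.+1) (tbar k.+1)) (vq / K) i (rshift _ a).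
  rewrite /Gi col_mxEd; apply => b; have := GK b.
  by rewrite /ybar G_stack.
- apply: le_trans avgK; rewrite avgE.
  by apply: le_trans (enorm_usubmx_le _); rewrite col_mxKu.
- move=> i iV; apply: le_trans eqK; rewrite /ybar Bs_stack.
  exact: (enorm_submxcol_le (fun i => sparse_eq (xbar it k.+1) i - bs P i)).
have xsD := optimal_dom hP hslater hxstar.
have -> : (\sum_(i < n) (Fo (xbar it k.+1 i) - Fo (xstar i))
         = (objective (xbar it k.+1) - objective (xpart ystar))%:E)%E.
  rewrite -(optimal_values hP hslater hxstar hystar) /objective -sumrB -sumEFin.
  by apply: eq_bigr => i _; rewrite (Fo_dom hP (xD i)) (Fo_dom hP (xsD i)).
rewrite !lee_fin; apply/andP; split; last first.
  rewrite ler_pdivlMr// mulrC mulrBr; apply: le_trans sum_obj.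
  rewrite sumrB lerB ?objective_xbar//.
  by rewrite big_const_nat iter_addr_0 subn1 /= mulr_natl.
have := saddle_stack (tbar k.+1) xD; rewrite -/(ybar k.+1).
have h1 : dot qstar (G (ybar k.+1)) <= vq / K * dot (const_mx 1) qstar.
  rewrite !dotE mulr_sumr; apply: ler_sum => a _; rewrite [const_mx _ _ _]mxE mul1r mulrC.
  by rewrite ler_wpM2r//; have := qs0 a; rewrite mxE.
have h2 : dot ustar ((ones_kronI P)^T *m (B P *m ybar k.+1 - c P))
    <= enorm ustar * (rho * vu / K).
  by apply: le_trans (dot_le _ _) _; rewrite ler_wpM2l ?enorm_ge0.
have h3 : dot vstar (Bs P *m ybar k.+1 - cs P) <= enorm vstar * (vv / (gamma * K)).
  by apply: le_trans (dot_le _ _) _; rewrite ler_wpM2l ?enorm_ge0.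
have -> : RPhi PW PH gamma lambda rho alpha it ystar qstar ustar vstar / K
  = vq / K * dot (const_mx 1) qstar + enorm ustar * (rho * vu / K)
    + enorm vstar * (vv / (gamma * K)).
  by rewrite /RPhi -/vq -/vu -/vv; field; rewrite !gt_eqF.
move: h1 h2 h3.
move: (vq / K * _) (enorm ustar * _) (enorm vstar * _) => a b d; lra.
Qed.

End Iterates.

Theorem corollary1 (R : realType) (n : nat) (P : problem R n) (e : rel 'I_n)
  (PW PH : 'M[R]_n) (gamma lambda rho alpha Lf Lg Lgs : R)
  (it : iterates P) (xstar : forall i, 'cV[R]_(dx P i)) (ystar : 'cV[R]_(ydim P))
  (qstar : 'cV[R]_(qdim P)) (ustar : 'cV[R]_(mt P + pt P)) (vstar : 'cV[R]_(vdim P))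
  (hP : well_formed P) (he : comm_graph P e)
  (hgamma : 0 < gamma) (hlambda : 0 < lambda) (hrho : 0 < rho) (halpha : 0 < alpha)
  (* (i)-(iv) *)
  (hsupp : forall i j, j \notin nbhd e i -> PW i j = 0 /\ PH i j = 0)
  (hpsdW : psd PW) (hpsdH : psd PH)
  (hW1 : PW *m const_mx 1 = const_mx 1 :> 'cV[R]_n)
  (hnullH : forall x : 'cV[R]_n, PH *m x = 0 <-> exists a : R, x = a *: const_mx 1)
  (hWH : psd (1%:M - (PW + PH)))
  (* (a)-(f) *)
  (hdom : forall i, convex_set (M := 'cV[R]_(dx P i)) (dom P i))
  (hfconv : forall i, convex_function (E := 'cV[R]_(dx P i)) (dom P i) (fo P i))
  (hhconv : forall i, convex_function (E := 'cV[R]_(dx P i)) (dom P i)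
                        (fun x => fine (ho P i x)))
  (hfdiff : forall i x, dom P i x ->
              differentiable (fo P i : 'cV[R]_(dx P i) -> R^o) x)
  (hLf : 0 < Lf) (hflip : forall i, lip_on (dom P i) Lf (grad (fo P i)))
  (hgconv : forall i, convex_vfunction (dom P i) (gc P i))
  (hLg : 0 < Lg) (hglip : forall i, lip_on (dom P i) Lg (gc P i))
  (hgsconv : forall i j, i \in Vin P -> j \in Sin P i ->
               convex_vfunction (dom P j) (gs P i j))
  (hLgs : 0 < Lgs)
  (hgslip : forall i j, i \in Vin P -> j \in Sin P i ->
              lip_on (dom P j) Lgs (gs P i j))
  (hxstar : optimal xstar)
  (hslater : exists xt : forall i, 'cV[R]_(dx P i), slater xt)
  (hrun : iplux_run e PW PH gamma lambda rho alpha it)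
  (hystar : optimalR ystar)
  (hmult : geometric_multiplier ystar qstar ustar vstar)
  (hLalpha : Lf + Lconst P Lg Lgs ^+ 2 <= alpha)
  (hLlambda : spectral_norm (Bs P) <= lambda) :
  let vq := Vq PW PH gamma lambda rho alpha it ystar qstar ustar vstar in
  let vu := Vu PW PH gamma lambda rho alpha it ystar qstar ustar vstar in
  let vv := Vv PW PH gamma lambda rho alpha it ystar qstar ustar vstar in
  let rPhi := RPhi PW PH gamma lambda rho alpha it ystar qstar ustar vstar in
  let rPhi' := R0 PW PH gamma lambda rho alpha it ystar in
  [/\ 0 <= vq, 0 <= vu, 0 <= vv, 0 <= rPhi & 0 <= rPhi'] /\
  forall k : nat, (1 <= k)%N ->
  [/\ vle (\sum_i gc P i (xbar it k i)) (const_mx ((n%:R * vq + rho * vu) / k%:R)),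
      forall i, i \in Vin P -> vle (sparse_in (xbar it k) i) (const_mx (vq / k%:R)),
      enorm (\sum_i (Ac P i *m xbar it k i - bc P i)) <= rho * vu / k%:R,
      forall i, i \in Veq P ->
        enorm (sparse_eq (xbar it k) i - bs P i) <= vv / (gamma * k%:R) &
      ((- (rPhi / k%:R))%:E
         <= \sum_(i < n) (Fo (xbar it k i) - Fo (xstar i))
         <= (rPhi' / k%:R)%:E)%E].
Proof.
move=> vq vu vv rPhi rPhi'.
apply: (averaged_rates (e := e) (Lf := Lf) (Lg := Lg) (Lgs := Lgs)) => //; eassumption.
Qed.
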